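(* Let $1 < p < q < \infty$, and let $r > 1$ be a real number such that $r \notin \{p,q\}$. Then $J_r$ does not coarse Lipschitz embed into $J_p \oplus J_q$; that is, there is no map $f : J_r \to J_p\oplus J_q$ which is a coarse Lipschitz embedding.
   Context: Here $\mathbb{N}=\{0,1,2,\dots\}$. For $1<p<\infty$, the James space $J_p$ is the (real) Banach space of all sequences $x:\mathbb{N}\to\mathbb{R}$ with $x(n)\to 0$ and $\|x\|_{J_p} = \sup_{p_1<\dots<p_n}\big(\sum_{i=1}^{n-1}|x(p_{i+1})-x(p_i)|^p\big)^{1/p}<\infty$, the supremum being over all finite increasing sequences $p_1<\dots<p_n$ in $\mathbb{N}$, equipped with the norm $\|\cdot\|_{J_p}$. The direct sum $J_p\oplus J_q$ carries any of the usual equivalent product norms, e.g. $\|(x,y)\|=\max\{\|x\|_{J_p},\|y\|_{J_q}\}$ (coarse Lipschitz embeddability does not depend on the choice of equivalent norm). A map $f:M\to N$ between metric spaces $(M,d)$ and $(N,\delta)$ is a coarse Lipschitz embedding if there exist $\theta, A, B>0$ such that for all $x,y\in M$: $d(x,y)\ge\theta \Rightarrow A\,d(x,y)\le \delta(f(x),f(y))\le B\,d(x,y)$. If such an $f$ exists, $M$ is said to coarse Lipschitz embed into $N$. Banach spaces are regarded as metric spaces via the norm distance. *)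

(* Defs.v *)
From HB Require Import structures.
From mathcomp Require Import all_boot all_order all_algebra.
From mathcomp Require Import all_classical all_reals all_analysis.
From mathcomp Require Import ring lra.

Set Implicit Arguments.
Unset Strict Implicit.
Unset Printing Implicit Defensive.

Import Order.TTheory GRing.Theory Num.Theory.
Import numFieldNormedType.Exports.

Local Open Scope classical_set_scope.
Local Open Scope ring_scope.

Section metric_embeddings.
Context {R : realType}.

Definition coarse_lipschitz_embedding (M N : metricType R) (f : M -> N) :=
  exists theta A B : R, [/\ 0 < theta, 0 < A, 0 < B &
    forall x y : M, theta <= mdist x y ->
      A * mdist x y <= mdist (f x) (f y) <= B * mdist x y].

Definition coarse_lipschitz_embeds (M N : metricType R) :=
  exists f : M -> N, coarse_lipschitz_embedding f.

(* The library gives a normedModType its balls but no [metricType] structure;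
   [norm_metric V] is V with the distance `|x - y|. *)
Definition norm_metric (V : normedModType R) : Type := V.

Section norm_metric.
Variable V : normedModType R.

HB.instance Definition _ := PseudoPointedMetric.on (norm_metric V).

Let dist (x y : norm_metric V) : R := `|(x : V) - (y : V)|.

Let dist_ge0 x y : 0 <= dist x y.
Proof. exact: normr_ge0. Qed.

Let dist_positivity x y : dist x y = 0 -> x = y.
Proof. by move/normr0_eq0/eqP; rewrite subr_eq0 => /eqP. Qed.

Let ballEdist (x : norm_metric V) d : ball x d = [set y | dist x y < d].
Proof. exact: (congr1 (fun b => b x d) (esym (@ball_normE R V))). Qed.

HB.instance Definition _ := PseudoMetric_isMetric.Build R (norm_metric V)
  dist_ge0 dist_positivity ballEdist.

Lemma norm_metricE (x y : norm_metric V) : mdist x y = `|(x : V) - (y : V)|.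
Proof. by []. Qed.

End norm_metric.
End metric_embeddings.

Section james_norm.
Context {R : realType}.
Implicit Types (p : R) (x y : nat -> R) (s : seq nat).

(* s lists p_1 < ... < p_n; the lists of length at most 1 contribute 0. *)
Definition james_var p x s : R :=
  (\sum_(i < (size s).-1) `|x (nth 0%N s i.+1) - x (nth 0%N s i)| `^ p) `^ p^-1.

Definition james_norm p x : \bar R :=
  ereal_sup [set (james_var p x s)%:E | s in [set s | sorted ltn s]].

Definition james p : {pred nat -> R} :=
  [pred x : nat -> R | `[< x @ \oo --> 0 /\ (james_norm p x < +oo)%E >]].

Lemma jamesP p x :
  reflect (x @ \oo --> 0 /\ (james_norm p x < +oo)%E) (x \in james p).
Proof. exact: asboolP. Qed.

Lemma james_norm_ge p x s : sorted ltn s ->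
  ((james_var p x s)%:E <= james_norm p x)%E.
Proof. by move=> ss; apply: ereal_sup_ubound; exists s. Qed.

Lemma james_norm_le p x (a : R) :
  (forall s, sorted ltn s -> james_var p x s <= a) ->
  (james_norm p x <= a%:E)%E.
Proof. by move=> h; apply: ge_ereal_sup => _ [s /h ? <-]; rewrite lee_fin. Qed.

Lemma james_norm_ge0 p x : (0 <= james_norm p x)%E.
Proof.
apply: le_trans (james_norm_ge p x (s := [::]) _) => //.
by rewrite lee_fin powR_ge0.
Qed.

Lemma james_norm_fin_num p x : (james_norm p x < +oo)%E ->
  james_norm p x \is a fin_num.
Proof. by move=> ?; rewrite ge0_fin_numE// james_norm_ge0. Qed.

Variable p : R.
Hypothesis p1 : 1 < p.

Let p0 : 0 < p. Proof. exact: lt_trans p1. Qed.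

Lemma james_var_le x s (a : R) : 0 <= a ->
  (james_var p x s <= a) =
  (\sum_(i < (size s).-1) `|x (nth 0%N s i.+1) - x (nth 0%N s i)| `^ p
     <= a `^ p).
Proof.
move=> a0; rewrite /james_var; set S := \sum_(i < _) _.
have S0 : 0 <= S by apply: sumr_ge0 => i _; exact: powR_ge0.
have pV0 : 0 <= p^-1 by rewrite invr_ge0 ltW.
have pp : p * p^-1 = 1 by rewrite divff// gt_eqF.
apply/idP/idP => h.
- have := ge0_ler_powR (ltW p0) _ _ h.
  rewrite -powRrM mulrC pp powRr1// => -> //; rewrite nnegrE //.
  exact: powR_ge0.
- have := ge0_ler_powR pV0 _ _ h.
  by rewrite -powRrM pp powRr1// => -> //; rewrite nnegrE // powR_ge0.
Qed.

Lemma minkowski_sum n (f g : 'I_n -> R) (a b : R) : 0 < a -> 0 < b ->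
  \sum_i `|f i| `^ p <= a `^ p -> \sum_i `|g i| `^ p <= b `^ p ->
  \sum_i `|f i + g i| `^ p <= (a + b) `^ p.
Proof.
move=> a0 b0 fa gb; have ab0 : 0 < a + b by exact: addr_gt0.
have abN0 : a + b != 0 by rewrite gt_eqF.
pose t := a / (a + b); pose u := b / (a + b).
have tu : t + u = 1 by rewrite -mulrDl divff.
have t0 : 0 <= t by rewrite divr_ge0// ltW.
have u0 : 0 <= u by rewrite divr_ge0// ltW.
have t1 : t <= 1 by rewrite -tu lerDl.
have scale (h : 'I_n -> R) c : 0 < c -> \sum_i `|h i| `^ p <= c `^ p ->
    \sum_i (`|h i| / c) `^ p <= 1.
  move=> c0 hc; have cp0 : 0 < c `^ p by exact: powR_gt0.
  rewrite -(ler_pM2r cp0) mul1r mulr_suml; apply: le_trans hc.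
  apply: ler_sum => i _; rewrite -powRM ?divr_ge0// ?(ltW c0)//.
  by rewrite divfK// gt_eqF.
have key i : `|f i + g i| `^ p <=
    (a + b) `^ p * (t * (`|f i| / a) `^ p + u * (`|g i| / b) `^ p).
  have := @convex_powR R p (ltW p1) (Itv01 t0 t1) (`|f i| / a) (`|g i| / b).
  rewrite !inE/= !in_itv/= !andbT.
  move=> /(_ (divr_ge0 (normr_ge0 _) (ltW a0))).
  move=> /(_ (divr_ge0 (normr_ge0 _) (ltW b0))).
  rewrite convRE [X in X `^ _ <= _ -> _]convRE /=.
  have -> : unstable.onem t = u by rewrite /unstable.onem -tu addrC addKr.
  rewrite -(ler_pM2l (powR_gt0 p ab0)) => h; apply: le_trans h.
  have fg0 : 0 <= t * (`|f i| / a) + u * (`|g i| / b).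
    by rewrite addr_ge0// mulr_ge0// divr_ge0// ltW.
  rewrite -powRM ?(ltW ab0)//.
  rewrite ge0_ler_powR ?nnegrE ?(ltW p0)// ?mulr_ge0// ?(ltW ab0)//.
  suff -> : (a + b) * (t * (`|f i| / a) + u * (`|g i| / b)) = `|f i| + `|g i|.
    exact: ler_normD.
  by rewrite /t /u; field; rewrite !gt_eqF.
apply: le_trans (ler_sum _ (fun i _ => key i)) _.
rewrite -mulr_sumr -[leRHS]mulr1 ler_pM2l ?powR_gt0//.
rewrite big_split/= -!mulr_sumr -tu lerD// -[leRHS]mulr1 ler_wpM2l//;
  exact: scale.
Qed.

Lemma james_normD x y :
  (james_norm p (x \+ y)%R <= james_norm p x + james_norm p y)%E.
Proof.
have [->|xoo] := eqVneq (james_norm p x) +oo%E.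
  by rewrite addye ?leey// -ltNye (lt_le_trans _ (james_norm_ge0 p y)).
have [->|yoo] := eqVneq (james_norm p y) +oo%E.
  by rewrite addey ?leey// -ltNye (lt_le_trans _ (james_norm_ge0 p x)).
have xf : james_norm p x \is a fin_num by move: xoo; rewrite -ltey; exact: james_norm_fin_num.
have yf : james_norm p y \is a fin_num by move: yoo; rewrite -ltey; exact: james_norm_fin_num.
have xE := fineK xf; have yE := fineK yf.
rewrite -xE -yE -EFinD; apply: james_norm_le => s ss.
apply/ler_addgt0Pr => e e0.
have e20 : 0 < e / 2 by rewrite divr_gt0.
pose a := fine (james_norm p x) + e / 2.
pose b := fine (james_norm p y) + e / 2.
have a0 : 0 < a by rewrite ltr_wpDl// fine_ge0// james_norm_ge0.
have b0 : 0 < b by rewrite ltr_wpDl// fine_ge0// james_norm_ge0.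
have -> : fine (james_norm p x) + fine (james_norm p y) + e = a + b.
  by rewrite /a /b addrACA -splitr.
have xa : james_var p x s <= a.
  by rewrite (@le_trans _ _ (fine (james_norm p x))) ?lerDl ?(ltW e20)// -lee_fin xE james_norm_ge.
have yb : james_var p y s <= b.
  by rewrite (@le_trans _ _ (fine (james_norm p y))) ?lerDl ?(ltW e20)// -lee_fin yE james_norm_ge.
rewrite (james_var_le _ _ (addr_ge0 (ltW a0) (ltW b0))).
rewrite james_var_le ?(ltW a0)// in xa; rewrite james_var_le ?(ltW b0)// in yb.
apply: le_trans (minkowski_sum a0 b0 xa yb); apply: ler_sum => i _.
by rewrite /= opprD addrACA.
Qed.

Lemma james_varZ (c : R) x s : james_var p (c \*: x) s = `|c| * james_var p x s.
Proof.
rewrite /james_var.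
have pN0 : p != 0 by rewrite gt_eqF.
under eq_bigr => i _.
  rewrite /= -[c *: _ - c *: _]scalerBr normrZ powRM//.
  over.
rewrite -mulr_sumr powRM ?powR_ge0//; last first.
  by apply: sumr_ge0 => i _; exact: powR_ge0.
by rewrite -powRrM divff// powRr1.
Qed.

Lemma james_normZ (c : R) x : (james_norm p (c \*: x) = `|c|%:E * james_norm p x)%E.
Proof.
rewrite /james_norm -ereal_supZl//; last first.
  by apply/set0P; exists (james_var p x [::])%:E; exists [::].
rewrite image_comp; congr ereal_sup; apply: eq_imagel => s _ /=.
by rewrite james_varZ EFinM.
Qed.

Lemma james_norm0_cst x m n : james_norm p x = 0%E -> x m = x n.
Proof.
move=> x0; wlog mn : m n / (m < n)%N.
  by move=> h; have [/h|/h/esym|->] := ltngtP m n.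
have /(james_norm_ge p x) : sorted ltn [:: m; n] by rewrite /= mn.
rewrite x0 lee_fin james_var_le// big_ord_recl big_ord0/= addr0.
rewrite powR0 ?gt_eqF// => h; apply/esym/eqP; rewrite -subr_eq0 -normr_eq0.
by have := le_anti (introT andP (conj h (powR_ge0 _ _))) => /powR_eq0_eq0 ->.
Qed.

Lemma james_submod_closed : submod_closed (james p).
Proof.
split.
  apply/jamesP; split; first exact: cvg_cst.
  have -> : (0 : nat -> R) = 0 \*: (0 : nat -> R).
    by apply/funext => n /=; rewrite scale0r.
  rewrite james_normZ normr0 mul0e; exact: ltry.
move=> c x y /jamesP[x0 xoo] /jamesP[y0 yoo]; apply/jamesP; split.
  suff : (c *: x + y) @ \oo --> c *: (0 : R) + 0 by rewrite scaler0 addr0.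
  by apply: cvgD => //; apply: cvgZ => //; exact: cvg_cst.
apply: le_lt_trans (james_normD (c \*: x) y) _.
have cxoo : (james_norm p (c \*: x) < +oo)%E.
  rewrite james_normZ.
  exact: (lte_mul_pinfty (normr_ge0 c : (0 <= `|c|%:E)%E) isT xoo).
exact: lte_add_pinfty cxoo yoo.
Qed.

End james_norm.

(* The normed space J_p.  The proof of 1 < p is a parameter of the type because
   the triangle inequality, hence the normed module structure, depends on it. *)
Record james_space {R : realType} (p : R) (p1 : 1 < p) : Type := JamesSpace {
  james_seq :> nat -> R;
  _ : james_seq \in james p }.

HB.instance Definition _ (R : realType) (p : R) (p1 : 1 < p) :=
  [isSub for @james_seq R p p1].

Section james_space.
Context {R : realType} (p : R) (p1 : 1 < p).

#[local] HB.instance Definition _ :=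
  GRing.isSubmodClosed.Build _ _ (james p) (james_submod_closed p1).

HB.instance Definition _ := [Choice of james_space p1 by <:].
HB.instance Definition _ := [SubChoice_isSubLmodule of james_space p1 by <:].

Definition james_space_norm (x : james_space p1) : R := fine (james_norm p x).

Lemma james_spaceP (x : james_space p1) :
  x @ \oo --> 0 /\ (james_norm p x < +oo)%E.
Proof. exact/jamesP/(valP x). Qed.

Lemma james_space_normE (x : james_space p1) :
  (james_space_norm x)%:E = james_norm p x.
Proof. by apply/fineK/james_norm_fin_num; case: (james_spaceP x). Qed.

Let normD (x y : james_space p1) :
  james_space_norm (x + y) <= james_space_norm x + james_space_norm y.
Proof.
have := james_normD p1 x y.
rewrite -(james_space_normE x) -(james_space_normE y) => h.
rewrite -lee_fin [leRHS]EFinD; apply: le_trans h.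
by rewrite (james_space_normE (x + y)).
Qed.

Let normZ (c : R) (x : james_space p1) :
  james_space_norm (c *: x) = `|c| * james_space_norm x.
Proof.
have := james_normZ p1 c x.
rewrite -(james_space_normE x) -(james_space_normE (c *: x)).
by rewrite -EFinM => -[].
Qed.

Let norm0_eq0 (x : james_space p1) : james_space_norm x = 0 -> x = 0.
Proof.
move=> nx0; have x0 : james_norm p x = 0%E by rewrite -james_space_normE nx0.
have [cx _] := james_spaceP x.
have xcst n : (x : nat -> R) = cst (x n).
  by apply: funext => m; exact: (james_norm0_cst p1 m n x0).
have x_eq0 n : x n = 0.
  by apply: (cvg_unique _ _ cx) => //; rewrite (xcst n); exact: cvg_cst.
by apply: val_inj; exact: funext x_eq0.
Qed.

HB.instance Definition _ :=
  Lmodule_isNormed.Build R (james_space p1) normD normZ norm0_eq0.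

Lemma james_space_normrE (x : james_space p1) :
  `|x|%:E = james_norm p (james_seq x).
Proof. exact: james_space_normE. Qed.

End james_space.

(* Main.v *)
From HB Require Import structures.
Require Import Defs.
From mathcomp Require Import all_boot all_order all_algebra.
From mathcomp Require Import all_classical all_reals all_analysis.
From mathcomp Require Import ring lra zify.
Import Order.TTheory GRing.Theory Num.Theory.
Import numFieldNormedType.Exports.
Local Open Scope ring_scope.
Set Implicit Arguments.
Unset Strict Implicit.
Unset Printing Implicit Defensive.

(* Write J_p(+)J_q = V(+)W, where V collects the summands with exponent < r and
   W those with exponent > r, and suppose f : J_r -> V(+)W is a coarse Lipschitz
   embedding.  In J_r consider the points m + a 1_s with s a set of k integers:
   changing one element of s moves such a point by O(a), while interlaced sets s
   and t yield points at distance at least a k^(1/r).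

   Exponents u > r.  Taking successive coordinatewise limits along a nonprincipal
   ultrafilter, one selects interlaced s, t for which the difference of the
   J_u-components of the two images is a sum of k almost disjoint blocks of size
   O(a).  J_u is only quasi-reflexive: a block of a single image may have a
   nonzero limit at infinity, but these limits cancel in the difference.  Hence
   the components are O(a k^(1/u)) = o(a k^(1/r)) apart.

   Exponents u < r.  The function f maps approximate midpoints of a suitable pair
   of distant points x, y to approximate midpoints of their images.  If
   m = (x + y)/2, the points m + a 1_s are approximate midpoints as soon as s lies
   far away and a k^(1/r) is small with respect to |x - y|; approximate midpoints
   in V are, up to a tail small with respect to a k^(1/r), determined by finitely
   many coordinates, and these coordinates can be made almost equal.

   Both components of f (m + a 1_s) - f (m + a 1_t) are thus small with respect
   to a k^(1/r), a contradiction. *)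

(* Unfolding these makes unification diverge. *)
#[local] Opaque james_norm james_var james_space_norm.

(** * Variation along chains *)

Section chains.
Context {R : realType}.
Implicit Types (p : R) (x y : nat -> R) (s t : seq nat).

(** The variation is kept as a p-th power, with the first point of the chain split off, so that
    concatenating chains adds the values. *)
Fixpoint vpath p x a s : R :=
  if s is b :: t then `|x b - x a| `^ p + vpath p x b t else 0.

Lemma vpath_ge0 p x a s : 0 <= vpath p x a s.
Proof. by elim: s a => //= b s IH a; rewrite addr_ge0 ?powR_ge0. Qed.

Lemma eq_vpath p x y a s : {in a :: s, x =1 y} -> vpath p x a s = vpath p y a s.
Proof.
elim: s a => //= b s IH a xy.
rewrite !xy ?inE ?eqxx ?orbT// IH// => j js; apply: xy.
by rewrite inE js orbT.
Qed.

Lemma vpath_cat p x a s t :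
  vpath p x a (s ++ t) = vpath p x a s + vpath p x (last a s) t.
Proof. by elim: s a => [|b s IH] a /=; rewrite ?add0r// IH addrA. Qed.

Lemma vpath_map p x (h : nat -> nat) a s :
  vpath p (x \o h) a s = vpath p x (h a) (map h s).
Proof. by elim: s a => //= b s IH a; rewrite IH. Qed.

Lemma james_sum_vpath p x a s :
  \sum_(i < (size (a :: s)).-1)
    `|x (nth 0%N (a :: s) i.+1) - x (nth 0%N (a :: s) i)| `^ p = vpath p x a s.
Proof.
elim: s a => [|b s IH] a; first by rewrite big_ord0.
by rewrite big_ord_recl /= -IH.
Qed.

End chains.

HB.lock Definition jnorm {R : realType} (p : R) (x : nat -> R) : R :=
  fine (james_norm p x).

Section james_norm_chains.
Context {R : realType} (p : R) (p1 : 1 < p).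
Implicit Types (x y : nat -> R) (s t : seq nat).

Let p0 : 0 < p. Proof. exact: lt_trans p1. Qed.

Lemma james_norm_leP x (M : R) : 0 <= M ->
  (james_norm p x <= M%:E)%E <->
  (forall a s, path ltn a s -> vpath p x a s <= M `^ p).
Proof.
move=> M0; split => [h a s ss|h].
  rewrite -james_sum_vpath -(james_var_le p1 _ _ M0) -lee_fin.
  exact: le_trans (james_norm_ge p x (ss : sorted ltn (a :: s))) h.
apply: james_norm_le => -[_|a s ss]; rewrite (james_var_le p1 _ _ M0).
  by rewrite big_ord0 powR_ge0.
by rewrite james_sum_vpath h.
Qed.

(* Repeated indices contribute zero increments, so weakly increasing chains
   may be used too; this makes reindexing by monotone maps immediate. *)
Lemma vpath_leq x a s : path leq a s ->
  exists2 t, path ltn a t & vpath p x a s = vpath p x a t.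
Proof.
elim: s a => [|b s IH] a /=; first by exists [::].
rewrite leq_eqVlt => /andP[/orP[/eqP <-|ab] /IH[t tp ->]].
  by exists t => //; rewrite subrr normr0 powR0 ?add0r// gt_eqF.
by exists (b :: t) => //=; rewrite ab.
Qed.

Lemma james_norm_vpath x (M : R) a s : 0 <= M -> (james_norm p x <= M%:E)%E ->
  path leq a s -> vpath p x a s <= M `^ p.
Proof. by move=> M0 /(james_norm_leP _ M0) h /(vpath_leq x)[t /h ? ->]. Qed.

Lemma james_norm_comp x (h : nat -> nat) : {homo h : i j / (i <= j)%N} ->
  (james_norm p (x \o h) <= james_norm p x)%E.
Proof.
move=> hh; have [xfin|] := boolP (james_norm p x < +oo)%E; last first.
  by rewrite -leNgt leye_eq => /eqP ->; exact: leey.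
rewrite -(fineK (james_norm_fin_num xfin)).
have M0 : 0 <= fine (james_norm p x) by rewrite fine_ge0// james_norm_ge0.
apply/(james_norm_leP _ M0) => a s ss.
rewrite vpath_map; apply: james_norm_vpath M0 _ _.
  by rewrite fineK// james_norm_fin_num.
elim: s a ss => //= b s IH a /andP[ab /IH ->].
by rewrite hh// ltnW.
Qed.

Local Notation jn := (jnorm p).

(** Bounded p-variation, without vanishing at infinity: coordinatewise limits of bounded families in
    J_p stay in this class but may leave J_p. *)
Definition bv x : Prop := exists M : R, (james_norm p x <= M%:E)%E.

Lemma bvE x : bv x <-> (james_norm p x < +oo)%E.
Proof.
split=> [[M h]|h]; first exact: le_lt_trans h (ltry M).
by exists (fine (james_norm p x)); rewrite (fineK (james_norm_fin_num h)).
Qed.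

Lemma jnE x : bv x -> (jn x)%:E = james_norm p x.
Proof. by rewrite jnorm.unlock => /bvE xf; exact: fineK (james_norm_fin_num xf). Qed.

Lemma jn_ge0 x : 0 <= jn x.
Proof. by rewrite jnorm.unlock; exact: fine_ge0 (james_norm_ge0 p x). Qed.

Lemma jn_leE x M : bv x -> (james_norm p x <= M%:E)%E = (jn x <= M).
Proof. by move=> xf; rewrite -(jnE xf) lee_fin. Qed.

Lemma bv_jn x M : (james_norm p x <= M%:E)%E -> bv x /\ jn x <= M.
Proof.
move=> h; have xf : bv x by exists M.
by split=> //; rewrite -(jn_leE _ xf).
Qed.

Lemma jn_leP x M : 0 <= M ->
  (bv x /\ jn x <= M) <-> (forall a s, path ltn a s -> vpath p x a s <= M `^ p).
Proof.
move=> M0; rewrite -(james_norm_leP _ M0).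
by split=> [[xf]|]; [rewrite -(jn_leE _ xf)|exact: bv_jn].
Qed.

Lemma vpath_jn x a s : bv x -> path leq a s -> vpath p x a s <= jn x `^ p.
Proof.
by move=> xf; apply: (james_norm_vpath (jn_ge0 x)); rewrite (jnE xf).
Qed.

Lemma bvD x y : bv x -> bv y -> bv (x \+ y).
Proof.
move=> /bvE xf /bvE yf; apply/bvE; apply: le_lt_trans (james_normD p1 x y) _.
exact: lte_add_pinfty xf yf.
Qed.

Lemma bvZ c x : bv x -> bv (c \*: x).
Proof.
move=> /bvE xf; apply/bvE; rewrite (james_normZ p1).
exact: (lte_mul_pinfty (normr_ge0 c : (0 <= `|c|%:E)%E) isT xf).
Qed.

Lemma jnD x y : bv x -> bv y -> jn (x \+ y) <= jn x + jn y.
Proof.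
move=> xf yf; rewrite -lee_fin [leRHS]EFinD (jnE xf) (jnE yf) (jnE (bvD xf yf)).
exact: james_normD.
Qed.

Lemma jnZ c x : bv x -> jn (c \*: x) = `|c| * jn x.
Proof.
move=> xf; apply: EFin_inj.
by rewrite [RHS]EFinM (jnE xf) (jnE (bvZ c xf)) (james_normZ p1).
Qed.

Lemma opp_funZ x : (fun j => - x j) = -1 \*: x.
Proof. by apply/funext => j /=; rewrite scaleN1r. Qed.

Lemma bvN x : bv x -> bv (fun j => - x j).
Proof. by move=> xf; rewrite opp_funZ; exact: bvZ. Qed.

Lemma jnN x : bv x -> jn (fun j => - x j) = jn x.
Proof. by move=> xf; rewrite opp_funZ (jnZ _ xf) normrN1 mul1r. Qed.

Lemma bvB x y : bv x -> bv y -> bv (x \- y).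
Proof. by move=> xf yf; exact: (@bvD x (fun j => - y j) xf (bvN yf)). Qed.

Lemma jnB x y : bv x -> bv y -> jn (x \- y) <= jn x + jn y.
Proof.
move=> xf yf; rewrite -(jnN yf).
exact: (@jnD x (fun j => - y j) xf (bvN yf)).
Qed.

Lemma bv_comp x (h : nat -> nat) : {homo h : i j / (i <= j)%N} ->
  bv x -> bv (x \o h) /\ jn (x \o h) <= jn x.
Proof.
by move=> hh xf; apply: bv_jn; rewrite (jnE xf); exact: james_norm_comp.
Qed.

Lemma powR_le_cancel (u v : R) : 0 <= u -> 0 <= v -> u `^ p <= v `^ p -> u <= v.
Proof.
move=> u0 v0; apply: contraTT; rewrite -!ltNge => vu.
exact: gt0_ltr_powR.
Qed.

Lemma jn_osc x i j : bv x -> `|x i - x j| <= jn x.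
Proof.
move=> xf; wlog ij : i j / (i <= j)%N.
  by move=> h; have [/h|/ltnW/h] := leqP i j => //; rewrite distrC.
have ss : path leq i [:: j] by rewrite /= ij.
have := vpath_jn xf ss; rewrite /= addr0 distrC.
by apply: powR_le_cancel; rewrite ?normr_ge0 ?jn_ge0.
Qed.

(** Truncation freezes the sequence at its value at [N] instead of cutting to zero. As a reindexing
    by a monotone map it creates no jump and does not increase the norm. *)
Definition head N x : nat -> R := x \o minn N.
Definition tail N x : nat -> R := x \o maxn N.

Let head_homo N : {homo minn N : i j / (i <= j)%N}.
Proof. by move=> i j ij; rewrite leq_min geq_minl geq_min ij orbT. Qed.

Let tail_homo N : {homo maxn N : i j / (i <= j)%N}.
Proof. by move=> i j ij; rewrite geq_max leq_maxl leq_max ij orbT. Qed.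

Lemma bv_head N x : bv x -> bv (head N x).
Proof. by case/(bv_comp (head_homo N)). Qed.

Lemma bv_tail N x : bv x -> bv (tail N x).
Proof. by case/(bv_comp (tail_homo N)). Qed.

Lemma tail_le N x : bv x -> jn (tail N x) <= jn x.
Proof. by case/(bv_comp (tail_homo N)). Qed.

Lemma tail_mono M N x : (M <= N)%N -> bv x -> jn (tail N x) <= jn (tail M x).
Proof.
move=> MN /(bv_tail M) /(bv_comp (tail_homo N))[_].
congr (jn _ <= _); apply/funext => j /=; rewrite /tail /=; congr x; lia.
Qed.

Lemma head_mono M N x : (M <= N)%N -> bv x -> jn (head M x) <= jn (head N x).
Proof.
move=> MN /(bv_head N) /(bv_comp (head_homo M))[_].
congr (jn _ <= _); apply/funext => j /=; rewrite /head /=; congr x; lia.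
Qed.

(** A chain capped at [N] followed by a chain raised to [N] is a weakly increasing chain for [x];
    the increment joining them is nonnegative and is dropped. *)
Lemma head_tail N x : bv x ->
  jn (head N x) `^ p + jn (tail N x) `^ p <= jn x `^ p.
Proof.
move=> xf; have hf := bv_head N xf; have tf := bv_tail N xf.
have pV : p * p^-1 = 1 by rewrite divff// gt_eqF.
have root (y : nat -> R) (c : R) : bv y -> 0 <= c ->
    (forall a s, path ltn a s -> vpath p y a s <= c) -> jn y `^ p <= c.
  move=> yf c0 h.
  have cE : (c `^ p^-1) `^ p = c by rewrite -powRrM mulrC pV powRr1.
  rewrite -[leRHS]cE ge0_ler_powR ?nnegrE ?jn_ge0 ?powR_ge0 ?(ltW p0)//.
  have [_] : bv y /\ jn y <= c `^ p^-1; last by [].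
  by apply/jn_leP; rewrite ?powR_ge0// => a s /h; rewrite cE.
have key a s b t : path ltn a s -> path ltn b t ->
    vpath p (head N x) a s + vpath p (tail N x) b t <= jn x `^ p.
  move=> /(sub_path (@ltnW)) ss /(sub_path (@ltnW)) tt.
  rewrite (vpath_map p x (minn N)) (vpath_map p x (maxn N)).
  pose c := minn N a; pose s' := map (minn N) s.
  have pc : path leq c (s' ++ maxn N b :: map (maxn N) t).
    rewrite cat_path /=; apply/and3P; split.
    - by apply: (homo_path _ ss); exact: head_homo.
    - rewrite /c /s' last_map; lia.
    - by apply: (homo_path _ tt); exact: tail_homo.
  apply: le_trans (vpath_jn xf pc).
  by rewrite vpath_cat /= lerD2l lerDr powR_ge0.
(* The two suprema are taken one after the other, the other term being moved to the right-hand
   side. *)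
rewrite -lerBrDl; apply: (root _ _) => //.
  rewrite subr_ge0.
  by have [_ h] := bv_comp (head_homo N) xf;
    rewrite ge0_ler_powR ?nnegrE ?jn_ge0 ?(ltW p0).
move=> b t bt; rewrite lerBrDl -lerBrDr; apply: (root _ _) => //.
  rewrite subr_ge0; have := key 0%N [::] b t isT bt.
  by rewrite /= add0r.
by move=> a s ss; rewrite lerBrDr key.
Qed.

(** A chain of variation above [c] is finite, and truncating beyond its maximum leaves it
    unchanged. *)
Lemma head_cvg x c : bv x -> c < jn x -> exists N, c < jn (head N x).
Proof.
move=> xf cx; have [c0|c0] := ltP c 0.
  by exists 0%N; exact: lt_le_trans c0 (jn_ge0 _).
have [h|] := pselect (forall a s, path ltn a s -> vpath p x a s <= c `^ p).
  by have [_] := (jn_leP x c0).2 h; rewrite leNgt cx.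
move=> /existsNP[a /existsNP[s /not_implyP[ss /negP]]]; rewrite -ltNge => h.
exists (\max_(j <- a :: s) j).
rewrite ltNge; apply/negP => h'.
have hf := bv_head (\max_(j <- a :: s) j) xf.
have := (jn_leP _ c0).1 (conj hf h') a s ss.
rewrite leNgt => /negP; apply; apply: lt_le_trans h _.
rewrite (@eq_vpath _ _ (head (\max_(j <- a :: s) j) x) x)// => j js.
rewrite /head /=; congr x; apply/minn_idPr.
by rewrite (big_rem j js) leq_maxl.
Qed.

(** Once the head carries all but e^p of the p-th power of the norm, [head_tail] leaves at most e^p
    for the tail. *)
Lemma tail_small x (e : R) : bv x -> 0 < e ->
  exists N, forall M, (N <= M)%N -> jn (tail M x) <= e.
Proof.
move=> xf e0; suff [N h] : exists N, jn (tail N x) <= e.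
  by exists N => M NM; exact: le_trans (tail_mono NM xf) h.
have ep : 0 < e `^ p by exact: powR_gt0.
have pV : p * p^-1 = 1 by rewrite divff// gt_eqF.
pose d := jn x `^ p - e `^ p.
have [xe|xe] := leP (jn x) e.
  exists 0%N; apply: le_trans xe.
  by have [] := bv_comp (tail_homo 0%N) xf.
have d0 : 0 <= d by rewrite subr_ge0 ge0_ler_powR ?nnegrE ?(ltW p0) ?(ltW e0) ?jn_ge0
  ?(ltW xe).
have dE : (d `^ p^-1) `^ p = d by rewrite -powRrM mulrC pV powRr1.
have dx : d `^ p^-1 < jn x.
  rewrite ltNge; apply/negP => h.
  have := @ge0_ler_powR _ _ (ltW p0) (jn x) (d `^ p^-1).
  rewrite !nnegrE jn_ge0 powR_ge0 dE => /(_ isT isT h).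
  by rewrite /d; lra.
have [N hN] := head_cvg xf dx; exists N.
apply: powR_le_cancel; rewrite ?jn_ge0 ?(ltW e0)//.
have := head_tail N xf.
have := @ge0_ler_powR _ _ (ltW p0) (d `^ p^-1) (jn (head N x)).
rewrite !nnegrE jn_ge0 powR_ge0 dE => /(_ isT isT (ltW hN)).
by rewrite /d; lra.
Qed.

End james_norm_chains.

(** * Elementary inequalities for real powers *)

Section powers.
Context {R : realType} (p : R) (p0 : 0 < p).

Lemma le_powR (u v : R) : 0 <= u -> u <= v -> u `^ p <= v `^ p.
Proof.
move=> u0 uv; rewrite ge0_ler_powR ?nnegrE ?(ltW p0)//.
exact: le_trans uv.
Qed.

Lemma powR_root (c : R) : 0 <= c -> (c `^ p^-1) `^ p = c.
Proof. by move=> c0; rewrite -powRrM mulVf ?gt_eqF// powRr1. Qed.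

Lemma root_powR (c : R) : 0 <= c -> (c `^ p) `^ p^-1 = c.
Proof. by move=> c0; rewrite -powRrM divff ?gt_eqF// powRr1. Qed.

Lemma powR_normB (u v : R) : `|u - v| `^ p <= 2 `^ p * (`|u| `^ p + `|v| `^ p).
Proof.
wlog uv : u v / `|u| <= `|v|.
  by move=> h; have [/h|/ltW/h] := leP `|u| `|v| => //;
    rewrite distrC (addrC (`|v| `^ p)).
have h : `|u - v| <= 2 * `|v|.
  by rewrite (le_trans (ler_normB _ _))// mulr2n mulrDl !mul1r lerD2r.
apply: le_trans (le_powR (normr_ge0 _) h) _.
by rewrite powRM// ler_wpM2l ?powR_ge0// lerDr powR_ge0.
Qed.

(** Choose l with (1 + l)^p = 1 + d. If v <= l u, the sum is at most (1 + l) u; otherwise it is at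
    most (1 + 1/l) v. *)
Lemma powR_addE (d : R) : 0 < d -> exists2 C : R, 0 < C &
  forall u v : R, 0 <= u -> 0 <= v -> (u + v) `^ p <= (1 + d) * u `^ p + C * v `^ p.
Proof.
move=> d0; have d1 : 0 <= 1 + d by rewrite addr_ge0// ltW.
pose l := (1 + d) `^ p^-1 - 1.
have lE : (1 + l) `^ p = 1 + d by rewrite /l addrC subrK powR_root.
have l0 : 0 < l.
  rewrite ltNge; apply/negP => l0.
  have l1 : 0 <= 1 + l by rewrite /l addrC subrK powR_ge0.
  have := @le_powR (1 + l) 1 l1.
  by rewrite lE powR1 gerDl => /(_ l0); rewrite gerDl leNgt d0.
have lV0 : 0 < 1 + l^-1 by rewrite addr_gt0 ?invr_gt0.
exists ((1 + l^-1) `^ p) => [|u v u0 v0]; first exact: powR_gt0.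
have [vu|uv] := leP v (l * u).
  apply: (@le_trans _ _ ((1 + d) * u `^ p)); last first.
    by rewrite lerDl mulr_ge0 ?powR_ge0.
  rewrite -lE -powRM//; last by rewrite addr_ge0// ltW.
  by apply: le_powR; [rewrite addr_ge0|rewrite mulrDl mul1r lerD2l].
apply: (@le_trans _ _ ((1 + l^-1) `^ p * v `^ p)); last first.
  by rewrite lerDr mulr_ge0 ?powR_ge0.
rewrite -powRM ?(ltW lV0)//.
apply: le_powR; first by rewrite addr_ge0.
by rewrite mulrDl mul1r addrC lerD2l ler_pdivlMl// ltW.
Qed.

End powers.

(** * Finitely supported perturbations and block estimates *)

Section perturbation.
Context {R : realType} (p : R) (p1 : 1 < p).
Implicit Types (x y : nat -> R) (s t l : seq nat).

Let p0 : 0 < p. Proof. exact: lt_trans p1. Qed.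

Lemma vpath_le_sum x a s :
  vpath p x a s <= 2 `^ (p + 1) * \sum_(j <- a :: s) `|x j| `^ p.
Proof.
suff : vpath p x a s <= 2 `^ (p + 1) * (\sum_(j <- a :: s) `|x j| `^ p)
                        - 2 `^ p * `|x a| `^ p.
  by move=> /le_trans; apply; rewrite gerBl mulr_ge0 ?powR_ge0.
have -> : 2 `^ (p + 1) = 2 * 2 `^ p :> R.
  by rewrite powRD ?pnatr_eq0 ?implybT// powRr1// mulrC.
elim: s a => [|b s IH] a.
  have := mulr_ge0 (powR_ge0 2 p) (powR_ge0 `|x a| p).
  by rewrite big_seq1 /=; lra.
rewrite big_cons /=; have := IH b; have := powR_normB p0 (x b) (x a).
by set S := \sum_(j <- _) _; set u := `|x b| `^ p; set v := `|x a| `^ p; lra.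
Qed.

Lemma jn_supp x l (c : R) : 0 <= c -> (forall j, `|x j| <= c) ->
  (forall j, j \notin l -> x j = 0) ->
  bv p x /\ jnorm p x <= (2 `^ (p + 1) * (size l)%:R) `^ p^-1 * c.
Proof.
move=> c0 xc xl; have K0 : 0 <= 2 `^ (p + 1) * (size l)%:R :> R.
  by rewrite mulr_ge0 ?powR_ge0.
apply/(jn_leP p1); rewrite ?mulr_ge0 ?powR_ge0// => a s ss.
rewrite powRM ?powR_ge0// powR_root//.
apply: le_trans (vpath_le_sum _ _ _) _.
rewrite -mulrA ler_wpM2l ?powR_ge0//.
have ua : uniq (a :: s) by apply: (sorted_uniq ltn_trans ltnn).
apply: (@le_trans _ _ (\sum_(j <- a :: s | j \in l) c `^ p)).
  rewrite [leRHS]big_mkcond /=; apply: ler_sum => j _.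
  by case: ifPn => [_|/xl ->]; [exact: le_powR|rewrite normr0 powR0// gt_eqF].
rewrite big_const_seq iter_addr_0 [leRHS]mulr_natl.
rewrite ler_wpMn2l ?powR_ge0// -size_filter.
apply: uniq_leq_size; first by rewrite filter_uniq.
by move=> j; rewrite mem_filter => /andP[].
Qed.

(** Chains inside [l] do not distinguish [x] from [y] plus an error supported on [l], whose norm
    [jn_supp] makes small. *)
Lemma vpath_close l (e : R) : 0 < e -> exists2 d : R, 0 < d &
  forall x y, bv p y -> (forall j, j \in l -> `|x j - y j| <= d) ->
  forall a s, path ltn a s -> {subset a :: s <= l} ->
    vpath p x a s <= (jnorm p y + e) `^ p.
Proof.
move=> e0; pose k : R := (2 `^ (p + 1) * (size l)%:R) `^ p^-1.
have k0 : 0 <= k by exact: powR_ge0.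
have k1 : 0 < k + 1 by rewrite ltr_wpDl.
exists (e / (k + 1)) => [|x y yf xy a s ss sl]; first exact: divr_gt0.
pose E j := if j \in l then x j - y j else 0.
have [Ef Ee] : bv p E /\ jnorm p E <= k * (e / (k + 1)).
  apply: jn_supp.
  - by rewrite divr_ge0// ltW.
  - by move=> j; rewrite /E; case: ifP => [/xy//|_]; rewrite normr0 divr_ge0// ltW.
  - by move=> j jl; rewrite /E (negbTE jl).
rewrite (@eq_vpath _ p x (y \+ E)); last first.
  by move=> j /sl jl; rewrite /E /= jl addrC subrK.
apply: le_trans (vpath_jn p1 (bvD p1 yf Ef) (sub_path (@ltnW) ss)) _.
apply: le_powR => //; first exact: jn_ge0.
apply: le_trans (jnD p1 yf Ef) _; rewrite lerD2l (le_trans Ee)//.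
by rewrite mulrCA ger_pMr// ler_pdivrMr// mul1r lerDl.
Qed.

Definition Phi N x (M : R) := forall a s, (N <= a)%N -> path ltn a s ->
  2 `^ p * `|x a| `^ p + vpath p x a s <= M.

Lemma path_split N s : exists s1 s2, [/\ s = s1 ++ s2, all (gtn N) s1 &
  if s2 is b :: _ then (N <= b)%N else True].
Proof.
elim: s => [|b s [s1 [s2 [-> s1N s2N]]]]; first by exists [::], [::].
have [Nb|bN] := leqP N b; first by exists [::], (b :: s1 ++ s2).
by exists (b :: s1), s2; split=> //=; rewrite bN.
Qed.

(* The weight on the first point of a chain pays for the increment by which
   a longer chain enters the block, so that the estimates of consecutive blocks
   add up without multiplicative loss. *)
Lemma Phi_block N N1 x (M M1 : R) : 0 <= M -> 0 <= M1 ->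
  (forall a s, (N <= a)%N -> path ltn a s -> all (gtn N1) (a :: s) ->
    2 `^ p * `|x a| `^ p + vpath p x a s + 2 `^ p * `|x (last a s)| `^ p <= M) ->
  Phi N1 x M1 -> Phi N x (M + M1).
Proof.
move=> M0 M10 hM hM1 a s Na ss.
have [N1a|aN1] := leqP N1 a; first by rewrite (le_trans (hM1 a s N1a ss))// lerDr.
have [s1 [[|b s2] [sE s1N bN]]] := path_split N1 s; subst s.
  rewrite cats0 in ss *; apply: le_trans (_ : M <= _); last by rewrite lerDl.
  apply: le_trans (hM a s1 Na ss _); last by rewrite /= aN1.
  by rewrite lerDl mulr_ge0 ?powR_ge0.
move: ss; rewrite cat_path /= => /and3P[ss1 _ ss2].
rewrite vpath_cat /=.
have := hM a s1 Na ss1; rewrite /= aN1 => /(_ s1N).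
have := hM1 b s2 bN ss2; have := powR_normB p0 (x b) (x (last a s1)).
by lra.
Qed.

Lemma jn_Phi x (M : R) : 0 <= M -> Phi 0 x M -> bv p x /\ jnorm p x <= M `^ p^-1.
Proof.
move=> M0 h; apply/(jn_leP p1); rewrite ?powR_ge0// => a s ss.
rewrite powR_root//; apply: le_trans (h a s isT ss).
by rewrite lerDr mulr_ge0 ?powR_ge0.
Qed.

Lemma vpath_tail N x a s : (N <= a)%N -> path ltn a s ->
  vpath p (tail N x) a s = vpath p x a s.
Proof.
move=> Na ss; apply: eq_vpath => j; rewrite inE => /orP js; congr x.
apply/maxn_idPr; case: js => [/eqP->//|js].
by rewrite (leq_trans Na)// ltnW// (allP (order_path_min ltn_trans ss) _ js).
Qed.

Lemma Phi_tail N x (c L : R) : `|x N| <= c -> bv p (tail N x) ->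
  jnorm p (tail N x) <= L -> Phi N x (2 `^ p * (c + L) `^ p + L `^ p).
Proof.
move=> xN tf tL a s Na ss.
have L0 : 0 <= L by exact: le_trans (jn_ge0 _ _) tL.
have xa : `|x a| <= c + L.
  have := jn_osc p1 a N tf; rewrite /tail /= (maxn_idPr Na) maxnn => h.
  rewrite -[x a](subrK (x N)) addrC (le_trans (ler_normD _ _))// lerD//.
  exact: le_trans tL.
rewrite lerD ?ler_wpM2l ?powR_ge0 ?le_powR//.
rewrite -(vpath_tail x Na ss).
apply: le_trans (vpath_jn p1 tf (sub_path (@ltnW) ss)) _.
by rewrite le_powR// jn_ge0.
Qed.

End perturbation.

(** * Iterated ultralimits of trees of sequences *)

Section ultralimits.
Local Open Scope classical_set_scope.
Context {R : realType} (U : set_system nat) {UU : UltraFilter U}.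
Hypothesis Uoo : forall N, U [set n | (N < n)%N].
Implicit Types (h : nat -> R).

Definition bounded_seq h := exists M : R, forall n, `|h n| <= M.
Definition ulim h : R := lim (h @ U).

(** The image of an ultrafilter is an ultrafilter, and it lives on the compact interval [-M, M]. *)
Lemma ulim_cvg h : bounded_seq h -> h @ U --> ulim h.
Proof.
move=> [M hM]; have := @segment_compact R (- M) M.
rewrite compact_ultra => /(_ (h @ U)) [].
- split; first exact: fmap_proper_filter.
  move=> G GF sG; apply/seteqP; split=> // A GA.
  have [//|UnA] := in_ultra_setVsetC (h @^-1` A) UU.
  have GnA : G (~` A) by exact: sG.
  by have [x [xA /(_ xA)]] := filter_ex (filterI GA GnA).
- by apply: (@filterE _ U _) => n; rewrite /= in_itv /= -ler_norml; exact: hM.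
- by move=> l [_ hl]; apply/cvg_ex; exists l.
Qed.

Lemma ulim_near h (c e : R) : bounded_seq h -> `|ulim h - c| < e ->
  U [set n | `|h n - c| < e].
Proof.
move=> hb; apply: (@cvgr_lt _ _ U _ (fun n => `|h n - c|)).
by apply: cvg_norm; apply: cvgB; [exact: ulim_cvg|exact: cvg_cst].
Qed.

Lemma ulim_le h (c e : R) : (forall n, `|h n - c| <= e) -> `|ulim h - c| <= e.
Proof.
move=> hc; have hb : bounded_seq h.
  exists (e + `|c|) => n; rewrite -[h n](subrK c).
  by rewrite (le_trans (ler_normD _ _))// lerD2r.
rewrite leNgt; apply/negP => lt.
pose d := `|ulim h - c| - e.
have : `|ulim h - ulim h| < d by rewrite subrr normr0 subr_gt0.
move=> /(ulim_near hb) /filter_ex[n /= hn].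
have := ler_normD (h n - c) (ulim h - h n).
rewrite (_ : h n - c + (ulim h - h n) = ulim h - c); last by ring.
rewrite (distrC (ulim h) (h n)); have := hc n; move: hn; rewrite /d.
by set u := `|ulim h - c|; set v := `|h n - ulim h|; set w := `|h n - c|; lra.
Qed.

Lemma ulimB h h' : bounded_seq h -> bounded_seq h' ->
  ulim (fun n => h n - h' n) = ulim h - ulim h'.
Proof.
by move=> hb hb'; apply/cvg_lim => //; apply: cvgB; exact: ulim_cvg.
Qed.

Lemma near_all (l : seq nat) (P : nat -> nat -> Prop) :
  (forall j, U [set n | P j n]) -> U [set n | forall j, j \in l -> P j n].
Proof.
move=> h; elim: l => [|i l IH]; first by apply: filterE => n j.
apply: filterS (filterI (h i) IH) => n /= [Pi Pl] j.
by rewrite inE => /orP[/eqP ->|/Pl].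
Qed.

(* [Ev k Q]: for most n_1, for most m_1, ..., for most n_k, for most m_k, one
   has [Q [:: n_1; ...; n_k] [:: m_1; ...; m_k]]. *)
Fixpoint Ev k (Q : seq nat -> seq nat -> Prop) : Prop :=
  if k is k'.+1 then
    U [set n | U [set m | Ev k' (fun s t => Q (n :: s) (m :: t))]]
  else Q [::] [::].

Lemma Ev_impl k (Q Q' : seq nat -> seq nat -> Prop) :
  (forall s t, size s = k -> size t = k -> Q s t -> Q' s t) ->
  Ev k Q -> Ev k Q'.
Proof.
elim: k Q Q' => [|k IH] Q Q' QQ' /=; first exact: QQ'.
apply: filterS => n /=; apply: filterS => m /=; apply: IH => s t sk tk.
by apply: QQ' => /=; rewrite ?sk ?tk.
Qed.

Lemma Ev_and k (Q Q' : seq nat -> seq nat -> Prop) :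
  Ev k Q -> Ev k Q' -> Ev k (fun s t => Q s t /\ Q' s t).
Proof.
elim: k Q Q' => [|k IH] Q Q' //= h h'.
apply: filterS (filterI h h') => n /= [hn hn'].
by apply: filterS (filterI hn hn') => m /= [hm hm']; exact: IH.
Qed.

Lemma Ev_ex k (Q : seq nat -> seq nat -> Prop) : Ev k Q ->
  exists s t, [/\ size s = k, size t = k & Q s t].
Proof.
elim: k Q => [|k IH] Q /=; first by exists [::], [::].
move=> /filter_ex[n /= /filter_ex[m /= /IH[s [t [sk tk h]]]]].
by exists (n :: s), (m :: t); rewrite /= sk tk.
Qed.

Fixpoint interlaced N s t : bool :=
  match s, t with
  | n :: s', m :: t' => [&& (N < n)%N, (n < m)%N & interlaced m s' t']
  | [::], [::] => true
  | _, _ => false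
  end.

Lemma Ev_interlaced k N : Ev k (interlaced N).
Proof.
elim: k N => [//|k IH] N /=.
apply: filterS (Uoo N) => n /= Nn; apply: filterS (Uoo n) => m /= nm.
by apply: Ev_impl (IH m) => s t _ _ ->; rewrite Nn nm.
Qed.

End ultralimits.

Section trees.
Local Open Scope classical_set_scope.
Context {R : realType} (p : R) (p1 : 1 < p).
Context (U : set_system nat) {UU : UltraFilter U}.
Hypothesis Uoo : forall N, U [set n | (N < n)%N].
Implicit Types (x y : nat -> R) (L : R) (s t : seq nat).
Implicit Types (g : seq nat -> nat -> R).

Let p0 : 0 < p. Proof. exact: lt_trans p1. Qed.
Local Notation ulim := (ulim U).

(** The coordinate bound is separate because [jnorm] vanishes on constants, which [bv] allows. *)
Definition jball L x := [/\ forall j, `|x j| <= L, bv p x & jnorm p x <= L].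

Lemma bv_bounded x : bv p x -> bounded_seq x.
Proof.
move=> xf; exists (jnorm p x + `|x 0%N|) => n.
rewrite -[x n](subrK (x 0%N)) (le_trans (ler_normD _ _))// lerD2r.
exact: jn_osc.
Qed.

(** Lower semicontinuity of the variation: a chain sees finitely many coordinates, where most [f n]
    are close to the limit. *)
Lemma jball_ulim L (f : nat -> nat ->
  R) y : (forall n, jball L (fun j => f n j - y j)) ->
  jball L (fun j => ulim (f ^~ j) - y j).
Proof.
move=> fL; have L0 : 0 <= L by have [/(_ 0%N) h _ _] := fL 0%N; exact: le_trans h.
have fb j : bounded_seq (f ^~ j).
  exists (L + `|y j|) => n; have [/(_ j) h _ _] := fL n.
  by rewrite -[f n j](subrK (y j)) (le_trans (ler_normD _ _))// lerD2r.
suff [? ?] : bv p (fun j => ulim (f ^~ j) - y j) /\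
    jnorm p (fun j => ulim (f ^~ j) - y j) <= L.
  by split=> // j; apply: ulim_le => n; have [/(_ j)] := fL n.
apply/(jn_leP p1) => // a s ss.
set v := vpath _ _ _ _; have v0 : 0 <= v by exact: vpath_ge0.
rewrite -(powR_root p0 v0) le_powR ?powR_ge0//.
apply/ler_addgt0Pr => e e0.
have [d d0 hd] := vpath_close p1 (a :: s) e0.
have near j : U [set n | `|f n j - ulim (f ^~ j)| < d].
  by apply: (@ulim_near _ U UU (f ^~ j)) => //; rewrite subrr normr0.
have [n /= hn] := filter_ex (@near_all U UU (a :: s) _ near).
have [_ nf nL] := fL n.
rewrite -(@root_powR _ p p0 (L + e)); last by rewrite addr_ge0// ltW.
rewrite le_powR ?invr_gt0//.
apply: le_trans (hd _ _ nf _ a s ss _) _ => //.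
- move=> j /hn /ltW; rewrite distrC.
  by rewrite (_ : _ - _ = ulim (f ^~ j) - y j - (f n j - y j))//; ring.
- by apply: le_powR => //; [rewrite addr_ge0 ?jn_ge0// ltW|rewrite lerD2r].
Qed.

(** A Lipschitz condition for the Hamming distance on lists, which may have any length and need not
    be increasing. *)
Definition tree L g := (forall s, bv p (g s)) /\
  (forall s n m t, jball L (fun j => g (s ++ n :: t) j - g (s ++ m :: t) j)).

Definition subtree g n := fun s => g (n :: s).

Lemma tree_subtree L g n : tree L g -> tree L (subtree g n).
Proof.
by move=> [gf gL]; split=> [s|s m m' t]; [exact: gf|exact: (gL (n :: s))].
Qed.

Lemma subtree_jball L g n m s : tree L g ->
  jball L (fun j => subtree g n s j - subtree g m s j).
Proof. by move=> [_ /(_ [::] n m s)]. Qed.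

Fixpoint tree_lim k g : nat -> R :=
  if k is k'.+1 then fun j => ulim (fun n => tree_lim k' (subtree g n) j) else g [::].

Lemma tree_lim_jball k L g g' : tree L g -> tree L g' ->
  (forall s, jball L (fun j => g s j - g' s j)) ->
  jball L (fun j => tree_lim k g j - tree_lim k g' j).
Proof.
elim: k g g' => [|k IH] g g' gT gT' h /=; first exact: h.
have b (g1 : seq nat -> nat -> R) j : tree L g1 ->
  bounded_seq (fun n => tree_lim k (subtree g1 n) j).
  move=> gT1; exists (L + `|tree_lim k (subtree g1 0) j|) => n.
  have [/(_ j) hj _ _] := IH _ _ (tree_subtree n gT1) (tree_subtree 0 gT1)
    (fun s => subtree_jball n 0 s gT1).
  rewrite -[X in `|X| <= _](subrK (tree_lim k (subtree g1 0) j)).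
  by rewrite (le_trans (ler_normD _ _))// lerD2r.
rewrite (_ : (fun j => _) =
  (fun j => ulim (fun n => tree_lim k (subtree g n) j - tree_lim k (subtree g' n) j)
    - 0)); last first.
  by apply/funext => j; rewrite subr0 (ulimB (b g j gT) (b g' j gT')).
apply: (@jball_ulim L (fun n j => tree_lim k (subtree g n) j - tree_lim k (subtree g'
  n) j) (fun=> 0)) => n.
rewrite (_ : (fun j => _) = (fun j => tree_lim k (subtree g n) j - tree_lim k
  (subtree g' n) j)).
  by apply: IH => [||s]; [exact: tree_subtree|exact: tree_subtree|exact: h].
by apply/funext => j; rewrite subr0.
Qed.

Lemma tree_lim_subtree_jball k L g n m : tree L g ->
  jball L (fun j => tree_lim k (subtree g n) j - tree_lim k (subtree g m) j).
Proof.
move=> gT; apply: tree_lim_jball; [exact: tree_subtree|exact: tree_subtree|].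
by move=> s; exact: subtree_jball.
Qed.

Lemma tree_lim_subtree_bounded k L g j : tree L g ->
  bounded_seq (fun n => tree_lim k (subtree g n) j).
Proof.
move=> gT; exists (L + `|tree_lim k (subtree g 0) j|) => n.
have [/(_ j) hj _ _] := tree_lim_subtree_jball k n 0 gT.
rewrite -[X in `|X| <= _](subrK (tree_lim k (subtree g 0) j)).
by rewrite (le_trans (ler_normD _ _))// lerD2r.
Qed.

Lemma tree_limS_jball k L g m : tree L g ->
  jball L (fun j => tree_lim k.+1 g j - tree_lim k (subtree g m) j).
Proof.
move=> gT; apply: (@jball_ulim L (fun n => tree_lim k (subtree g n))) => n.
exact: tree_lim_subtree_jball.
Qed.

Lemma bv_tree_lim k L g : tree L g -> bv p (tree_lim k g).
Proof.
elim: k g => [|k IH] g gT; first exact: gT.1.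
have [_ h _] := tree_limS_jball k 0 gT.
rewrite (_ : tree_lim k.+1 g = (fun j => tree_lim k.+1 g j - tree_lim k (subtree g 0)
  j) \+ tree_lim k (subtree g 0)).
  by apply: (bvD p1 h); apply: IH; exact: tree_subtree.
by apply/funext => j /=; rewrite subrK.
Qed.

(* Iterated limits of the values at infinity of the successive partial limits
   [tree_lim]. *)
Fixpoint tree_lim_oo k i g : R :=
  match k, i with
  | k'.+1, 0%N => ulim (fun n => ulim (tree_lim k' (subtree g n)))
  | k'.+1, i'.+1 => ulim (fun n => tree_lim_oo k' i' (subtree g n))
  | 0%N, _ => 0
  end.

Lemma ulim_tree_lim_le k L g g' : tree L g -> tree L g' ->
  (forall s, jball L (fun j => g s j - g' s j)) ->
  `|ulim (tree_lim k g) - ulim (tree_lim k g')| <= L.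
Proof.
move=> gT gT' h; have [hL _ _] := tree_lim_jball k gT gT' h.
rewrite -(ulimB (bv_bounded (bv_tree_lim k gT)) (bv_bounded (bv_tree_lim k gT'))).
rewrite -[X in `|X|]subr0; apply: ulim_le => n.
by rewrite subr0.
Qed.

Lemma tree_lim_oo_le k i L g g' : tree L g -> tree L g' ->
  (forall s, jball L (fun j => g s j - g' s j)) ->
  `|tree_lim_oo k i g - tree_lim_oo k i g'| <= L.
Proof.
elim: k i g g' => [|k IH] i g g' gT gT' h.
  by have [/(_ 0%N) h0 _ _] := h [::]; rewrite /= subrr normr0 (le_trans _ h0).
have L0 : 0 <= L by have [/(_ 0%N) h0 _ _] := h [::]; rewrite (le_trans _ h0).
have bd (u : nat -> R) : (forall n, `|u n - u 0%N| <= L) -> bounded_seq u.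
  move=> uL; exists (L + `|u 0%N|) => n; rewrite -[u n](subrK (u 0%N)).
  by rewrite (le_trans (ler_normD _ _))// lerD2r.
have lim2 (u v : nat -> R) : bounded_seq u -> bounded_seq v ->
  (forall n, `|u n - v n| <= L) ->
    `|ulim u - ulim v| <= L.
  move=> ub vb uv; rewrite -(ulimB ub vb) -[X in `|X|]subr0.
  by apply: ulim_le => n; rewrite subr0.
case: i => [|i] /=; apply: lim2.
- by apply: bd => n; apply: ulim_tree_lim_le;
  [exact: tree_subtree|exact: tree_subtree|move=> s; exact: subtree_jball].
- by apply: bd => n; apply: ulim_tree_lim_le;
  [exact: tree_subtree|exact: tree_subtree|move=> s; exact: subtree_jball].
- by move=> n; apply: ulim_tree_lim_le;
  [exact: tree_subtree|exact: tree_subtree|move=> s; exact: h].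
- by apply: bd => n; apply: IH; [exact: tree_subtree|exact: tree_subtree|move=> s;
  exact: subtree_jball].
- by apply: bd => n; apply: IH; [exact: tree_subtree|exact: tree_subtree|move=> s;
  exact: subtree_jball].
- by move=> n; apply: IH; [exact: tree_subtree|exact: tree_subtree|move=> s; exact: h].
Qed.

Lemma bounded_tree_lim_oo k i L g : tree L g ->
  bounded_seq (fun n => tree_lim_oo k i (subtree g n)).
Proof.
move=> gT; exists (L + `|tree_lim_oo k i (subtree g 0)|) => n.
rewrite -[X in `|X| <= _](subrK (tree_lim_oo k i (subtree g 0))).
rewrite (le_trans (ler_normD _ _))// lerD2r.
by apply: tree_lim_oo_le; [exact: tree_subtree|exact: tree_subtree|move=> s;
  exact: subtree_jball].
Qed.

Lemma bounded_ulim_tree_lim k L g : tree L g ->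
  bounded_seq (fun n => ulim (tree_lim k (subtree g n))).
Proof.
move=> gT; exists (L + `|ulim (tree_lim k (subtree g 0))|) => n.
rewrite -[X in `|X| <= _](subrK (ulim (tree_lim k (subtree g 0)))).
rewrite (le_trans (ler_normD _ _))// lerD2r.
by apply: ulim_tree_lim_le; [exact: tree_subtree|exact: tree_subtree|move=> s;
  exact: subtree_jball].
Qed.

End trees.

(** * Concentration of differences over interlaced sets *)

Section concentration.
Local Open Scope classical_set_scope.
Context {R : realType} (p : R) (p1 : 1 < p).
Context (U : set_system nat) {UU : UltraFilter U}.
Hypothesis Uoo : forall N, U [set n | (N < n)%N].
Implicit Types (x y : nat -> R) (L : R) (s t : seq nat).
Implicit Types (g : seq nat -> nat -> R).

Let p0 : 0 < p. Proof. exact: lt_trans p1. Qed.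

Lemma tree_lim_subtree_near k L g (e : R) N : tree p L g -> 0 < e ->
  U [set n | forall j, j \in iota 0 N.+1 ->
    `|tree_lim U k (subtree g n) j - tree_lim U k.+1 g j| < e].
Proof.
move=> gT e0; apply: near_all => j.
apply: (@ulim_near _ U UU (fun n => tree_lim U k (subtree g n) j)).
  exact: (tree_lim_subtree_bounded p1 k j gT).
by rewrite /= subrr normr0.
Qed.

(** On [N, N1) the coordinates of [x] are at most L + 3 L + L = 5 L, so each weighted endpoint costs
    at most (10 L)^p. The chain itself costs at most (3 L + L)^p. *)
Lemma block_bound N N1 y L : 0 < L -> bv p (tail N y) ->
    jnorm p (tail N y) <= 3 * L -> `|y N1| <= L -> (N <= N1)%N ->
  exists2 d : R, 0 < d & forall x, (forall j, (j <= N1)%N -> `|x j - y j| <= d) ->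
    forall a s, (N <= a)%N -> path ltn a s -> all (gtn N1) (a :: s) ->
    2 `^ p * `|x a| `^ p + vpath p x a s + 2 `^ p * `|x (last a s)| `^ p
      <= 3 * (10 * L) `^ p.
Proof.
move=> L0 tf tL yN1 NN1.
have [d d0 hd] := vpath_close p1 (iota 0 N1) L0.
exists (Num.min d L) => [|x xy a s Na ss sN1]; first by rewrite lt_min d0.
have sN j : j \in a :: s -> (N <= j < N1)%N.
  move=> js; have /= -> := allP sN1 _ js; rewrite andbT.
  move: js; rewrite inE => /orP[/eqP ->//|js].
  by rewrite (leq_trans Na)// ltnW// (allP (order_path_min ltn_trans ss) _ js).
have xL j : (N <= j < N1)%N -> 2 `^ p * `|x j| `^ p <= (10 * L) `^ p.
  move=> /andP[Nj jN1]; rewrite -powRM//.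
  apply: le_powR => //.
  rewrite (_ : 10 * L = 2 * (5 * L)); last by ring.
  rewrite ler_pM2l//.
  have h1 : `|x j - y j| <= L.
    by rewrite (le_trans (xy _ (ltnW jN1)))// ge_min lexx orbT.
  have h2 : `|y j - y N1| <= 3 * L.
    have := jn_osc p1 j N1 tf.
    rewrite /tail /= (maxn_idPr Nj) (maxn_idPr NN1) => /le_trans; exact.
  rewrite (_ : x j = (x j - y j) + (y j - y N1) + y N1); last by ring.
  rewrite (le_trans (ler_normD _ _))//.
  have := ler_normD (x j - y j) (y j - y N1); move: h1 h2 yN1.
  by lra.
have xa := xL a (sN a (mem_head _ _)).
have xl := xL _ (sN _ (mem_last a s)).
have : vpath p x a s <= (10 * L) `^ p.
  rewrite -(vpath_tail p x Na ss).
  apply: le_trans (hd _ _ tf _ a s ss _) _.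
  - move=> j; rewrite mem_iota /= add0n => jN1.
    have jN : (maxn N j <= N1)%N by rewrite geq_max NN1 ltnW.
    by apply: le_trans (xy _ jN) _; rewrite ge_min lexx.
  - by move=> j /sN; rewrite mem_iota /= => /andP[].
  - by apply: le_powR => //; [rewrite addr_ge0 ?jn_ge0 ?ltW|lra].
by lra.
Qed.

(** Induction on [k]. After [n] and [m] are chosen, the difference [D1] of the next partial limits
    replaces [D0]. A cut [N1] is placed where [D1] is small and nearly constant beyond; [N, N1) is
    one block, and the remaining pairs act from [N1] on. The condition on [tree_lim_oo] makes the
    limits at infinity cancel at every later stage. *)
Lemma concentration_step L g g' k N (e : R) :
    0 < L -> 0 < e -> tree p L g -> tree p L g' ->
    (forall i, (i < k)%N -> `|tree_lim_oo U k i g - tree_lim_oo U k i g'| < L) ->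
    let D0 j := tree_lim U k g j - tree_lim U k g' j in
    jnorm p (tail N D0) <= L -> `|D0 N| <= L ->
  Ev U k (fun s t => let D j := g s j - g' t j in
    (forall j, (j <= N)%N -> `|D j - D0 j| <= e) /\
    Phi p N D (k.+1%:R * (3 * (10 * L) `^ p))).
Proof.
elim: k g g' N e => [|k IH] g g' N e L0 e0 gT gT' hoo D0 tD0 D0N.
  split=> [j _|]; first by rewrite subrr normr0 ltW.
  have D0f : bv p D0 by apply: (bvB p1); [exact: gT.1|exact: gT'.1].
  have := Phi_tail p1 D0N (bv_tail p1 N D0f) tD0.
  rewrite -powRM ?addr_ge0 ?ltW// => h a s Na ss.
  apply: le_trans (h a s Na ss) _; rewrite mul1r.
  have : (2 * (L + L)) `^ p <= (10 * L) `^ p by apply: le_powR => //; lra.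
  have : L `^ p <= (10 * L) `^ p by apply: le_powR => //; lra.
  have := powR_ge0 (10 * L) p; lra.
(* The error budget: e/4 for [n], e/4 for [m], and e/2 for the remaining pairs. *)
have e40 : 0 < e / 4 by rewrite divr_gt0.
(* The strict inequalities of [hoo] are open conditions, so they survive for most [n] against the
   limits of [g'], and then for most [m] against those of [subtree g' m]. *)
have near1 (i : nat) : U [set n | (i < k)%N ->
    `|tree_lim_oo U k i (subtree g n) - tree_lim_oo U k.+1 i.+1 g'| < L].
  case: (ltnP i k) => ik; last by apply: filterE => n /=.
  have := @ulim_near _ U UU _ (tree_lim_oo U k.+1 i.+1 g') L (@bounded_tree_lim_oo _
    _ p1 U UU k i _ _ gT).
  by move=> /(_ (hoo i.+1 ik)); apply: filterS => n /= h _.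
have near2 := @ulim_near _ U UU _ (tree_lim_oo U k.+1 0 g') L (@bounded_ulim_tree_lim
  _ _ p1 U UU k _ _ gT) (hoo 0%N isT).
have near3 := tree_lim_subtree_near k N gT e40.
have near4 := @near_all U UU (iota 0 k) _ near1.
rewrite /=; apply: filterS (filterI (filterI near2 near3) near4).
move=> n /= [[n2 n3] n4].
have near1' (i : nat) : U [set m | (i < k)%N ->
    `|tree_lim_oo U k i (subtree g n) - tree_lim_oo U k i (subtree g' m)| < L].
  case: (ltnP i k) => ik; last by apply: filterE => m /=.
  have ik' : i \in iota 0 k by rewrite mem_iota.
  have := n4 i ik' ik; rewrite distrC => h.
  have := @ulim_near _ U UU _ _ L (@bounded_tree_lim_oo _ _ p1 U UU k i _ _ gT') h.
  by apply: filterS => m /= + _; rewrite distrC.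
have near2' : U [set m | `|ulim U (tree_lim U k (subtree g n)) - ulim U (tree_lim U k
  (subtree g' m))| < L].
  move: n2; rewrite distrC => h.
  have := @ulim_near _ U UU _ _ L (@bounded_ulim_tree_lim _ _ p1 U UU k _ _ gT') h.
  by apply: filterS => m /=; rewrite distrC.
have near3' := tree_lim_subtree_near k N gT' e40.
have near4' := @near_all U UU (iota 0 k) _ near1'.
apply: filterS (filterI (filterI near2' near3') near4').
move=> m /= [[m2 m3] m4].
pose D1 j := tree_lim U k (subtree g n) j - tree_lim U k (subtree g' m) j.
have gnT := tree_subtree n gT; have gmT := tree_subtree m gT'.
have f1 := @bv_tree_lim _ _ p1 U UU k _ _ gnT; have f2 :=
  @bv_tree_lim _ _ p1 U UU k _ _ gmT.
have D1f : bv p D1 by exact: (bvB p1 f1 f2).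
have [N2 hN2] := tail_small p1 D1f L0.
(* By the choice of [m], the limit of [D1] along [U] is below [L] in absolute value, so arbitrarily
   far coordinates are too. *)
have [N1 /= [hN1 N1b]] : exists j, `|D1 j| < L /\ (maxn N N2 < j)%N.
  have u0 : `|ulim U D1 - 0| < L.
    by rewrite subr0 (ulimB (bv_bounded p1 f1) (bv_bounded p1 f2)).
  have near0 := @ulim_near _ U UU D1 0 L (bv_bounded p1 D1f) u0.
  have [j /= [h1 h2]] := filter_ex (filterI near0 (Uoo (maxn N N2))).
  by exists j; rewrite -[D1 j]subr0.
have NN1 : (N <= N1)%N := ltnW (leq_ltn_trans (leq_maxl _ _) N1b).
have [_ g1f g1L] := @tree_limS_jball _ _ p1 U UU k _ _ n gT; have [_ g2f g2L] :=
  @tree_limS_jball _ _ p1 U UU k _ _ m gT'.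
have D0f : bv p D0 by apply: (bvB p1);
  [exact: (bv_tree_lim p1 k.+1 gT)|exact: (bv_tree_lim p1 k.+1 gT')].
(* [D1] differs from [D0] by one limit step in each tree, and each step has norm at most [L]. *)
have tD1 : jnorm p (tail N D1) <= 3 * L.
  rewrite (_ : tail N D1 = (tail N D0
    \- tail N (fun j => tree_lim U k.+1 g j - tree_lim U k (subtree g n) j))
    \+ tail N (fun j => tree_lim U k.+1 g' j - tree_lim U k (subtree g' m) j));
      last first.
    by apply/funext => j; rewrite /tail /D0 /D1 /=; ring.
  have t0 := bv_tail p1 N D0f; have t1 := bv_tail p1 N g1f.
  have t2 := bv_tail p1 N g2f.
  have := jnD p1 (bvB p1 t0 t1) t2; have := jnB p1 t0 t1.
  have := tail_le p1 N g1f; have := tail_le p1 N g2f; move: tD0 g1L g2L.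
  by lra.
have [d d0 hd] := block_bound L0 (bv_tail p1 N D1f) tD1 (ltW hN1) NN1.
pose e1 := Num.min d (e / 2).
have e10 : 0 < e1 by rewrite lt_min d0 divr_gt0.
have foo1 i : (i < k)%N ->
  `|tree_lim_oo U k i (subtree g n) - tree_lim_oo U k i (subtree g' m)| < L.
  by move=> ik; apply: m4 => //; rewrite mem_iota.
have tN1 : jnorm p (tail N1 D1) <= L by apply: hN2;
  exact: ltnW (leq_ltn_trans (leq_maxr _ _) N1b).
have := IH (subtree g n) (subtree g' m) N1 e1 L0 e10 gnT gmT foo1 tN1 (ltW hN1).
apply: Ev_impl => s t _ _ [close phi]; split.
  move=> j jN; have jN1 : (j <= N1)%N := leq_trans jN NN1.
  have jN' : j \in iota 0 N.+1 by rewrite mem_iota.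
  have h1 : `|g (n :: s) j - g' (m :: t) j - D1 j| <= e / 2.
    by rewrite (le_trans (close j jN1))// /e1 ge_min lexx orbT.
  have h2 := n3 j jN'; have h3 := m3 j jN'.
  rewrite (_ : _ - D0 j = (g (n :: s) j - g' (m :: t) j - D1 j)
    + ((tree_lim U k (subtree g n) j - tree_lim U k.+1 g j) - (tree_lim U k (subtree
      g' m) j - tree_lim U k.+1 g' j)));
    last by rewrite /D1 /D0; ring.
  have := ler_normD (g (n :: s) j - g' (m :: t) j - D1 j)
    ((tree_lim U k (subtree g n) j - tree_lim U k.+1 g j) - (tree_lim U k (subtree g'
      m) j - tree_lim U k.+1 g' j)).
  have := ler_normB (tree_lim U k (subtree g n) j - tree_lim U k.+1 g j) (tree_lim U
    k (subtree g' m) j - tree_lim U k.+1 g' j).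
  by move: h1 h2 h3; lra.
have M0 : 0 <= 3 * (10 * L) `^ p by rewrite mulr_ge0 ?powR_ge0.
rewrite -[k.+2%:R]natr1 addrC mulrDl mul1r.
apply: (Phi_block p1 M0 _ _ phi); first by rewrite mulr_ge0.
apply: hd => j jN1; apply: le_trans (close j jN1) _.
by rewrite /e1 ge_min lexx.
Qed.

(** For two equal trees the initial difference vanishes and the limits at infinity coincide. The
    p-th power of the norm then grows only linearly in [k]. *)
Lemma concentration L g k N (e : R) : 0 < L -> 0 < e -> tree p L g ->
  Ev U k (fun s t => let D j := g s j - g t j in
    (forall j, (j <= N)%N -> `|D j| <= e) /\
    Phi p N D (k.+1%:R * (3 * (10 * L) `^ p))).
Proof.
move=> L0 e0 gT.
have z : (fun j => tree_lim U k g j - tree_lim U k g j) = 0 \*: tree_lim U k g.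
  by apply/funext => j /=; rewrite subrr scale0r.
have Ff := @bv_tree_lim _ _ p1 U UU k _ _ gT.
have := @concentration_step L g g k N e L0 e0 gT gT.
rewrite /= subrr normr0 => /(_ _ _ (ltW L0)) h.
apply: Ev_impl (h _ _) => [s t _ _ [h1 h2]|i ik|].
- by split=> // j /h1; rewrite subrr subr0.
- by rewrite subrr normr0.
- have zf := bvZ p1 0 Ff.
  apply: le_trans (tail_le p1 N _) _; rewrite z//.
  by rewrite (jnZ p1)// normr0 mul0r ltW.
Qed.

End concentration.

(** * Sums of spikes in James spaces *)

Section james_space_norm.
Local Open Scope classical_set_scope.
Context {R : realType} (p : R) (p1 : 1 < p).
Implicit Types (x y : james_space p1).

Lemma james_bv x : bv p x.
Proof. by apply/bvE; case: (james_spaceP x). Qed.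

Lemma james_normrE x : `|x| = jnorm p x.
Proof.
by apply: EFin_inj; rewrite (jnE (james_bv x)) james_space_normrE.
Qed.

Lemma james_seqD x y : james_seq (x + y) = (x : nat -> R) \+ y.
Proof. by []. Qed.

Lemma james_seqB x y : james_seq (x - y) = (x : nat -> R) \- y.
Proof. by []. Qed.

(** Vanishing at infinity turns oscillation into size: compare [x j] with [x n] as n grows. *)
Lemma james_normr_ge x j : `|x j| <= `|x|.
Proof.
have [x0 _] := james_spaceP x; rewrite james_normrE.
have : (fun n => `|x j - x n|) @ \oo --> `|x j - 0|.
  by apply: cvg_norm; apply: cvgB => //; exact: cvg_cst.
rewrite subr0 => /cvgr_to_le; apply.
by apply: nearW => n; exact: (jn_osc p1 _ _ (james_bv x)).
Qed.

Definition spikes (a : R) (s : seq nat) : nat -> R :=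
  fun j => if j \in s then a else 0.

Lemma spikes_bv a s : 0 <= a ->
  bv p (spikes a s) /\
  jnorm p (spikes a s) <= (2 `^ (p + 1) * (size s)%:R) `^ p^-1 * a.
Proof.
move=> a0; apply: jn_supp => // j; rewrite /spikes.
  by case: ifP; rewrite ?normr0// ger0_norm.
by move=> /negbTE ->.
Qed.

Lemma spikes_james (a : R) s : spikes `|a| s \in james p.
Proof.
have [h _] := spikes_bv s (normr_ge0 a).
apply/jamesP; split; last exact/bvE.
apply/cvgrPdist_lt => e e0; near=> n; rewrite sub0r normrN /spikes.
case: ifPn => [ns|_]; last by rewrite normr0.
have : (\max_(j <- s) j < n)%N by near: n; exact: nbhs_infty_gt.
rewrite ltnNge => /negP[].
by rewrite (big_rem n ns) leq_maxl.
Unshelve. all: by end_near. Qed.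

(* The absolute value makes [bump] total; it is used with [0 <= a]. *)
Definition bump (a : R) s : james_space p1 := JamesSpace p1 (spikes_james a s).

Lemma bumpE a s : 0 <= a -> james_seq (bump a s) = spikes a s.
Proof. by move=> a0; rewrite /= ger0_norm. Qed.

(** The difference is supported on {n, m}, so the bound does not depend on the number of spikes. *)
Lemma bump_change a s n m t : 0 <= a ->
  `|bump a (s ++ n :: t) - bump a (s ++ m :: t)|
    <= (2 `^ (p + 1) * 2) `^ p^-1 * a.
Proof.
move=> a0; rewrite james_normrE james_seqB !bumpE//.
have [] := @jn_supp _ _ p1 (spikes a (s ++ n :: t) \- spikes a (s ++ m :: t))
  [:: n; m] a a0 => // j; rewrite /spikes /=.
  by do 2?[case: ifP => _]; rewrite ?subrr ?subr0 ?sub0r ?normrN ?normr0// ger0_norm.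
rewrite !mem_cat !inE negb_or => /andP[/negbTE -> /negbTE ->].
by rewrite subrr.
Qed.

(** For [a] above the threshold of a coarse Lipschitz map, its estimates thus apply to every pair of
    distinct bumps. *)
Lemma bump_neq a s t : 0 <= a -> bump a s != bump a t ->
  a <= `|bump a s - bump a t|.
Proof.
move=> a0; apply: contraNT; rewrite -ltNge => h.
apply/eqP/val_inj => /=; apply/funext => j; rewrite ger0_norm//.
have := le_lt_trans (james_normr_ge _ j) h.
rewrite james_seqB !bumpE//= /spikes.
by do 2?[case: ifP => _]; rewrite ?subrr ?subr0 ?sub0r ?normrN ?ger0_norm// ltxx.
Qed.

Lemma interlaced_mem N s t : interlaced N s t ->
  (forall j, j \in s -> (N < j)%N /\ j \notin t) /\
  (forall j, j \in t -> (N < j)%N /\ j \notin s).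
Proof.
elim: s t N => [|n s IH] [|m t] N //= /and3P[Nn nm /IH[hs ht]].
split=> j; rewrite !inE => /orP[/eqP ->|js].
- split=> //; rewrite negb_or neq_ltn nm /=; apply/negP => /ht[mn _].
  by have := ltn_trans nm mn; rewrite ltnn.
- have [mj jt] := hs j js; split; first by rewrite (ltn_trans Nn)// (ltn_trans nm).
  by rewrite negb_or jt andbT neq_ltn mj orbT.
- split; first exact: ltn_trans nm.
  rewrite negb_or neq_ltn nm orbT /=; apply/negP => /hs[mm _].
  by rewrite ltnn in mm.
- have [mj js'] := ht j js; split; first by rewrite (ltn_trans Nn)// (ltn_trans nm).
  by rewrite negb_or js' andbT neq_ltn (ltn_trans nm mj) orbT.
Qed.

(** Along n_1, m_1, n_2, m_2, ... only the jump from [a] to [- a] inside each pair is counted. *)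
Lemma vpath_interlaced (a : R) (d : nat -> R) N s t : 0 <= a -> interlaced N s t ->
  {in s, forall j, d j = a} -> {in t, forall j, d j = - a} ->
  exists2 c, path ltn N c & (size s)%:R * a `^ p <= vpath p d N c.
Proof.
move=> a0; elim: s t N => [|n s IH] [|m t] N //=.
  by move=> _ _ _; exists [::] => //; rewrite mul0r.
move=> /and3P[Nn nm st] ds dt.
have [c mc hc] := IH t m st (fun j js => ds j (mem_behead (s := n :: s) js))
  (fun j jt => dt j (mem_behead (s := m :: t) jt)).
exists [:: n, m & c] => /=; first by rewrite Nn nm.
rewrite -natr1 mulrDl mul1r addrC (ds n) ?mem_head// (dt m) ?mem_head//.
have h : a `^ p <= `|- a - a| `^ p; last first.
  by apply: le_trans (lerD h hc) _; rewrite lerDr powR_ge0.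
rewrite le_powR ?(lt_trans ltr01)// -opprD normrN ger0_norm ?addr_ge0//.
by rewrite lerDl.
Qed.

Lemma bump_interlaced a N s t : 0 <= a -> interlaced N s t ->
  (size s)%:R `^ p^-1 * a <= `|bump a s - bump a t|.
Proof.
move=> a0 st; have p0 : 0 < p := lt_trans ltr01 p1.
have [hs ht] := interlaced_mem st.
have := @vpath_interlaced a (spikes a s \- spikes a t) N s t a0 st.
case=> [j /[dup] js /hs[_ /negbTE jt]|j /[dup] jt /ht[_ /negbTE js]|c Nc hc].
- by rewrite /= /spikes js jt subr0.
- by rewrite /= /spikes js jt sub0r.
apply: (powR_le_cancel p1); rewrite ?mulr_ge0 ?powR_ge0//.
rewrite powRM ?powR_ge0// powR_root// (le_trans hc)//.
rewrite james_normrE -[spikes a s]bumpE// -[spikes a t]bumpE// -james_seqB.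
by apply: (vpath_jn p1 (james_bv _)); exact: sub_path (@ltnW) _ _ Nc.
Qed.

(* Once the spikes are beyond the essential support of [v] they act as a
   perturbation disjoint from [v], except for a single increment of size [a];
   spreading the mass over many small spikes makes this exception harmless. *)
Lemma norm_add_spikes (d C : R) (v : nat -> R) N a s : 0 < d -> 0 <= C -> 0 <= a ->
  (forall u w : R, 0 <= u -> 0 <= w -> (u + w) `^ p <= (1 + d) * u `^ p + C * w `^ p) ->
  bv p v -> all (ltn N) s ->
  let t := (2 `^ (p + 1) * (size s)%:R) `^ p^-1 * a in
  jnorm p (tail N v) <= t ->
  jnorm p (v \+ spikes a s) `^ p <=
    (1 + d) * jnorm p v `^ p + (C * a `^ p + (2 * t) `^ p).
Proof.
move=> d0 C0 a0 hC vf sN t tv; have p0 : 0 < p := lt_trans ltr01 p1.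
have [zf zt] := spikes_bv s a0.
have t0 : 0 <= t by rewrite mulr_ge0 ?powR_ge0.
have tf := bv_tail p1 N vf.
have E0 : 0 <= C * a `^ p by rewrite mulr_ge0 ?powR_ge0.
have far c l : (N <= c)%N -> path ltn c l ->
  vpath p (v \+ spikes a s) c l <= (2 * t) `^ p.
  move=> Nc cl; rewrite (@eq_vpath _ _ _ (tail N v \+ spikes a s)); last first.
    move=> j jl; rewrite /tail /=; congr (v _ + _); apply/esym/maxn_idPr.
    move: jl; rewrite inE => /orP[/eqP->//|jl].
    by rewrite (leq_trans Nc)// ltnW// (allP (order_path_min ltn_trans cl) _ jl).
  apply: le_trans (vpath_jn p1 (bvD p1 tf zf) (sub_path (@ltnW) cl)) _.
  apply: le_powR => //; first exact: jn_ge0.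
  by rewrite (le_trans (jnD p1 tf zf))// mulr2n mulrDl mul1r lerD.
have near c l : (c <= N)%N -> path ltn c l -> vpath p (v \+ spikes a s) c l <=
    (1 + d) * vpath p v c l + (C * a `^ p + (2 * t) `^ p).
  have z0 j : (j <= N)%N -> spikes a s j = 0.
    by move=> jN; rewrite /spikes; case: ifP => // /(allP sN) /=; rewrite ltnNge jN.
  elim: l c => [|b l IH] c cN /=; first by rewrite mulr0 add0r addr_ge0 ?powR_ge0.
  move=> /andP[cb bl]; rewrite (z0 c cN) addr0.
  have [bN|Nb] := leqP b N.
    rewrite (z0 b bN) addr0; have := IH b bN bl.
    have : 0 <= d * `|v b - v c| `^ p by rewrite mulr_ge0 ?powR_ge0// ltW.
    by set u := `|_| `^ p; lra.
  have h1 := far b l (ltnW Nb) bl.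
  have h2 : `|v b + spikes a s b - v c| `^ p <= (1 + d) * `|v b - v c| `^ p + C * a
    `^ p.
    apply: le_trans (hC _ _ (normr_ge0 _) a0); apply: le_powR => //.
    rewrite addrAC (le_trans (ler_normD _ _))// lerD2l /spikes.
    by case: ifP; rewrite ?normr0// ger0_norm.
  have : 0 <= (1 + d) * vpath p v b l by rewrite mulr_ge0 ?vpath_ge0// addr_ge0// ltW.
  by move: h1 h2; lra.
have M0 : 0 <= (1 + d) * jnorm p v `^ p + (C * a `^ p + (2 * t) `^ p).
  by rewrite !addr_ge0 ?mulr_ge0 ?addr_ge0 ?powR_ge0// ltW.
rewrite -[leRHS](powR_root p0)//; apply: le_powR; rewrite ?jn_ge0//.
suff [] : bv p (v \+ spikes a s) /\ jnorm p (v \+ spikes a s) <=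
  ((1 + d) * jnorm p v `^ p + (C * a `^ p + (2 * t) `^ p)) `^ p^-1 by [].
apply/(jn_leP p1); rewrite ?powR_ge0// => c l cl; rewrite powR_root//.
have [cN|/ltnW Nc] := leqP c N.
  apply: le_trans (near c l cN cl) _; rewrite lerD2r ler_pM2l ?addr_gt0//.
  exact: (vpath_jn p1 vf (sub_path (@ltnW) cl)).
apply: le_trans (far c l Nc cl) _; rewrite addrA lerDr.
by rewrite addr_ge0// mulr_ge0 ?powR_ge0// addr_ge0// ltW.
Qed.

End james_space_norm.

(** * Lower estimates and approximate midpoints *)

Section lower_gauges.
Local Open Scope classical_set_scope.
Context {R : realType}.

(* [nu] plays the role of the s-th power of a norm with a lower s-estimate,
   [hd N] and [tl N] of the s-th powers of its restrictions to [0, N] and to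
   [N, oo).  Working with powers, these axioms are stable under sums, which
   handles the direct sum of two spaces. *)
Record lower_gauge (T : lmodType R) (s : R) (nu : T -> R) (hd tl : nat -> T -> R) :
  Prop := LowerGauge {
  gauge_ge0 : forall x, 0 <= nu x;
  gaugeZ : forall (c : R) x, nu (c *: x) = `|c| `^ s * nu x;
  gauge_hd : forall N w u, hd N w *+ 2 <= hd N (w + u) + hd N (w - u);
  gauge_tl : forall N w u, tl N u *+ 2 <= tl N (w + u) + tl N (w - u);
  gauge_split : forall N x, hd N x + tl N x <= nu x;
  gauge_cvg : forall x c, c < nu x ->
    exists N, forall M, (N <= M)%N -> c < hd M x }.

Lemma lower_gauge_prod (T1 T2 : lmodType R) s nu1 hd1 tl1 nu2 hd2 tl2 :
  @lower_gauge T1 s nu1 hd1 tl1 -> @lower_gauge T2 s nu2 hd2 tl2 ->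
  @lower_gauge (T1 * T2)%type s (fun x => nu1 x.1 + nu2 x.2)
    (fun N x => hd1 N x.1 + hd2 N x.2) (fun N x => tl1 N x.1 + tl2 N x.2).
Proof.
move=> g1 g2; split.
- by move=> x; rewrite addr_ge0 ?(gauge_ge0 g1) ?(gauge_ge0 g2).
- by move=> c x; rewrite /= (gaugeZ g1) (gaugeZ g2) mulrDr.
- move=> N w u; rewrite mulrnDl [leRHS]addrACA.
  exact: (lerD (gauge_hd g1 N w.1 u.1) (gauge_hd g2 N w.2 u.2)).
- move=> N w u; rewrite mulrnDl [leRHS]addrACA.
  exact: (lerD (gauge_tl g1 N w.1 u.1) (gauge_tl g2 N w.2 u.2)).
- move=> N x; rewrite addrACA.
  exact: (lerD (gauge_split g1 N x.1) (gauge_split g2 N x.2)).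
- move=> x c cx; pose e := (nu1 x.1 + nu2 x.2 - c) / 2.
  have e0 : 0 < e by rewrite divr_gt0// subr_gt0.
  have x1 : nu1 x.1 - e < nu1 x.1 by rewrite gtrBl.
  have x2 : nu2 x.2 - e < nu2 x.2 by rewrite gtrBl.
  have [N1 h1] := gauge_cvg g1 x1; have [N2 h2] := gauge_cvg g2 x2.
  exists (maxn N1 N2) => M; rewrite geq_max => /andP[/h1 + /h2].
  by rewrite /e; lra.
Qed.

Lemma powR_midpoint (s a b c : R) : 1 <= s -> 0 <= a -> 0 <= b -> 0 <= c ->
  a *+ 2 <= b + c -> a `^ s *+ 2 <= b `^ s + c `^ s.
Proof.
move=> s1 a0 b0 c0 abc.
have t0 : 0 <= 2^-1 :> R by rewrite invr_ge0.
have t1 : 2^-1 <= 1 :> R by rewrite invf_le1// ler1n.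
have := @convex_powR R s s1 (Itv01 t0 t1) b c.
rewrite !inE/= !in_itv/= !andbT => /(_ b0 c0).
rewrite convRE [X in X `^ _ <= _ -> _]convRE /=.
have -> : unstable.onem (2^-1 : R) = 2^-1 by rewrite /unstable.onem; lra.
rewrite -!mulrDr => h.
rewrite -mulr_natl -ler_pdivlMl//; apply: le_trans h.
apply: le_powR; rewrite ?(lt_le_trans ltr01)//.
by rewrite ler_pdivlMl// mulr_natl.
Qed.

(** The inclusion of l_p in l_s: for u <= c one has u^s <= u^p c^(s-p). *)
Lemma powR_superadd (p s a b c : R) : 0 < p -> p <= s -> 0 <= a -> 0 <= b -> 0 <= c ->
  a `^ p + b `^ p <= c `^ p -> a `^ s + b `^ s <= c `^ s.
Proof.
move=> p0 ps a0 b0 c0 h; have s0 : 0 < s := lt_le_trans p0 ps.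
have [cE|cN0] := eqVneq c 0; last first.
  have cp : 0 < c by rewrite lt_neqAle eq_sym cN0.
  have cps : 0 < c `^ p by exact: powR_gt0.
  have sp0 : 0 <= s - p by rewrite subr_ge0.
  have key (u : R) : 0 <= u -> u `^ p <= c `^ p -> u `^ s <= u `^ p * c `^ (s - p).
    move=> u0 uc; have ucc : u <= c.
      rewrite leNgt; apply/negP => cu.
      by have := gt0_ltr_powR p0 _ _ cu; rewrite !nnegrE ltNge uc => /(_ c0 u0).
    have [->|uN0] := eqVneq u 0.
      by rewrite powR0 ?gt_eqF// mulr_ge0 ?powR_ge0.
    have -> : u `^ s = u `^ p * u `^ (s - p).
      by rewrite -powRD ?uN0 ?implybT// addrC subrK.
    by rewrite ler_wpM2l ?powR_ge0// ge0_ler_powR ?nnegrE.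
  have -> : c `^ s = c `^ p * c `^ (s - p).
    by rewrite -powRD ?cN0 ?implybT// addrC subrK.
  apply: le_trans (lerD (key a a0 _) (key b b0 _)) _.
  - by apply: le_trans h; rewrite lerDl powR_ge0.
  - by apply: le_trans h; rewrite lerDr powR_ge0.
  - by rewrite -mulrDl ler_wpM2r ?powR_ge0.
move: h; rewrite cE [in X in _ <= X]powR0 ?gt_eqF// => h.
have /powR_eq0_eq0 -> : a `^ p = 0.
  by apply/le_anti; rewrite powR_ge0 andbT (le_trans _ h)// lerDl powR_ge0.
have /powR_eq0_eq0 -> : b `^ p = 0.
  by apply/le_anti; rewrite powR_ge0 andbT (le_trans _ h)// lerDr powR_ge0.
by rewrite powR0 ?addr0// gt_eqF.
Qed.

(** Allowing every s >= p lets two James spaces share one exponent in [lower_gauge_prod]. *)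
Lemma james_lower_gauge (p s : R) (p1 : 1 < p) : p <= s ->
  @lower_gauge (james_space p1) s (fun x => `|x| `^ s)
    (fun N x => jnorm p (head N x) `^ s) (fun N x => jnorm p (tail N x) `^ s).
Proof.
move=> ps; have p0 : 0 < p := lt_trans ltr01 p1.
have s0 : 0 < s := lt_le_trans p0 ps.
have s1 : 1 <= s := le_trans (ltW p1) ps.
split.
- by move=> x; exact: powR_ge0.
- by move=> c x; rewrite normrZ powRM.
- move=> N w u; apply: powR_midpoint => //; rewrite ?jn_ge0//.
  have h1 := bv_head p1 N (james_bv (w + u)); have h2 :=
    bv_head p1 N (james_bv (w - u)).
  have := jnD p1 h1 h2; rewrite (_ : _ \+ _ = 2 \*: head N w).
    by rewrite (jnZ p1 _ (bv_head p1 N (james_bv w))) ger0_norm// mulr_natl.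
  rewrite james_seqD james_seqB; apply/funext => j.
  by rewrite /head /= -[2 *: _]/(2 * w (minn N j)); ring.
- move=> N w u; apply: powR_midpoint => //; rewrite ?jn_ge0//.
  have h1 := bv_tail p1 N (james_bv (w + u)); have h2 :=
    bv_tail p1 N (james_bv (w - u)).
  have := jnB p1 h1 h2; rewrite (_ : _ \- _ = 2 \*: tail N u).
    by rewrite (jnZ p1 _ (bv_tail p1 N (james_bv u))) ger0_norm// mulr_natl.
  rewrite james_seqD james_seqB; apply/funext => j.
  by rewrite /tail /= -[2 *: _]/(2 * u (maxn N j)); ring.
- move=> N x; apply: (powR_superadd p0 ps); rewrite ?jn_ge0// james_normrE.
  exact: (head_tail p1 N (james_bv x)).
- move=> x c cx; have [c0|c0] := ltP c 0.
    by exists 0%N => M _; exact: lt_le_trans c0 (powR_ge0 _ _).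
  have lt1 : c `^ s^-1 < jnorm p x.
    rewrite -james_normrE -(root_powR s0 (normr_ge0 x)).
    by apply: gt0_ltr_powR; rewrite ?invr_gt0 ?nnegrE ?powR_ge0.
  have [N hN] := head_cvg p1 (james_bv x) lt1.
  exists N => M NM; rewrite -[ltLHS](powR_root s0)//.
  apply: gt0_ltr_powR; rewrite ?nnegrE ?powR_ge0 ?jn_ge0//.
  exact: (lt_le_trans hN (head_mono p1 NM (james_bv x))).
Qed.

Lemma norm_midpoint (V : normedModType R) (v z : V) :
  2 * `|v| <= `|v + z| + `|- v + z|.
Proof.
have := ler_normB (v + z) (- v + z).
by rewrite opprD opprK addrACA subrr addr0 -mulr2n normrMn mulr_natl.
Qed.

Lemma half_sum (V : lmodType R) (x y : V) :
  2^-1 *: (x + y) + 2^-1 *: (x - y) = x.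
Proof.
by rewrite -scalerDr addrACA subrr addr0 -mulr2n -[x *+ 2]scaler_nat scalerA mulVf
  ?scale1r//.
Qed.

Lemma half_diff (V : lmodType R) (x y : V) :
  2^-1 *: (x + y) - 2^-1 *: (x - y) = y.
Proof. by rewrite -scalerN opprB (addrC x) half_sum. Qed.

Lemma midpoint_subl (V : lmodType R) (x y z : V) :
  (2^-1 *: (x + y) + z) - y = 2^-1 *: (x - y) + z.
Proof.
rewrite -[X in _ - X](half_diff x y); set m := _ *: (x + y); set v := _ *: (x - y).
by rewrite opprB addrC addrA subrK.
Qed.

Lemma midpoint_subr (V : lmodType R) (x y z : V) :
  x - (2^-1 *: (x + y) + z) = - (- (2^-1 *: (x - y)) + z).
Proof.
rewrite -[X in X - _](half_sum x y); set m := _ *: (x + y); set v := _ *: (x - y).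
by rewrite opprD addrACA subrr add0r opprD opprK.
Qed.

(** * Images of approximate midpoints have small tails *)

Section compression.
Context (r : R) (r1 : 1 < r) (T : lmodType R) (s : R).
Context (nu : T -> R) (hd tl : nat -> T -> R).
Hypothesis gauge : lower_gauge s nu hd tl.
Context (f : james_space r1 -> T) (theta B : R).
Hypothesis s0 : 0 < s.
Hypothesis sr : s < r.
Hypothesis B0 : 0 <= B.
Hypothesis fB : forall x y, theta <= `|x - y| -> nu (f x - f y) <= B * `|x - y| `^ s.

Let r0 : 0 < r. Proof. exact: lt_trans ltr01 r1. Qed.

(** The Lipschitz constants of [f] at large distances, for s-th powers; their infimum is the
    asymptotic Lipschitz constant. *)
Let lip := [set L | exists t, forall x y, t <= `|x - y| ->
  nu (f x - f y) <= L * `|x - y| `^ s].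

(** By [spikes_bv], [k] spikes of height [a] have norm at most [kap k * a]. *)
Let kap (k : nat) : R := (2 `^ (r + 1) * k%:R) `^ r^-1.

Lemma far_points (t : R) : exists2 x : james_space r1, t <= `|x| & 0 < `|x|.
Proof.
pose a := Num.max t 1; have a1 : 0 < a by rewrite lt_max ltr01 orbT.
exists (bump r1 a [:: 0%N]); last first.
  apply: lt_le_trans (james_normr_ge _ 0%N).
  by rewrite bumpE ?(ltW a1)// /spikes mem_head gtr0_norm.
apply: le_trans (james_normr_ge _ 0%N).
by rewrite bumpE ?(ltW a1)// /spikes mem_head gtr0_norm// /a le_max lexx.
Qed.

Lemma lip_ge0 L : lip L -> 0 <= L.
Proof.
move=> [t hL]; have [x tx x0] := far_points t.
have := hL x 0; rewrite subr0 => /(_ tx) h.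
have := le_trans (gauge_ge0 gauge _) h.
by rewrite pmulr_lge0// powR_gt0.
Qed.

(* The asymptotic Lipschitz constant is almost attained at some distant pair
   x, y, so approximate midpoints of x, y are sent to approximate midpoints of
   f x, f y. *)
Lemma almost_extremal (d : R) : 0 < d -> exists2 L, 0 <= L <= B &
  exists2 t, forall x y, t <= `|x - y| -> nu (f x - f y) <= (L + d) * `|x - y| `^ s &
    forall t', exists x y, t' <= `|x - y| /\ (L - d) * `|x - y| `^ s < nu (f x - f y).
Proof.
move=> d0; have lB : lip B by exists theta.
have li : has_inf lip by split; [exists B|exists 0 => L /lip_ge0].
exists (inf lip).
  by rewrite lb_le_inf//= ?(ge_inf li.2 lB)//; [exists B|move=> L /lip_ge0].
have [L [t hL] Ld] := inf_adherent d0 li.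
exists t => [x y txy|t'].
  apply: le_trans (hL x y txy) _; rewrite ler_wpM2r ?powR_ge0//.
  by rewrite ltW.
have [//|h] := pselect (exists x y, t' <= `|x - y| /\
   (inf lip - d) * `|x - y| `^ s < nu (f x - f y)).
have : lip (inf lip - d).
  exists t' => x y txy; rewrite leNgt; apply/negP => lt; apply: h.
  by exists x, y.
by move=> /(ge_inf li.2); rewrite lerBrDl gerDr leNgt d0.
Qed.

(** Raise to the power v/u <= 1, which does not increase Q >= 1 beyond Q. *)
Lemma powR_ratio (u v y Q rho : R) : 0 < u -> 0 < v -> v <= u -> 1 <= Q -> 0 <= y ->
  0 <= rho -> y `^ u <= Q * rho `^ u -> y `^ v <= Q * rho `^ v.
Proof.
move=> u0 v0 vu Q1 y0 rho0 h; have Q0 : 0 <= Q := le_trans ler01 Q1.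
have vu0 : 0 < v / u by rewrite divr_gt0.
have := le_powR vu0 (powR_ge0 y u) h.
rewrite powRM ?powR_ge0// -!powRrM.
rewrite mulrC -mulrA mulVf ?gt_eqF// mulr1 => /le_trans; apply.
rewrite ler_wpM2r ?powR_ge0//.
by rewrite -[leRHS]powRr1// ler_powR// ler_pdivrMr// mul1r.
Qed.

Lemma powR_ratio2 (y Q rho : R) : 1 <= Q -> 0 <= y -> 0 <= rho ->
  y `^ r <= Q * rho `^ r -> y <= Q * rho /\ y `^ s <= Q * rho `^ s.
Proof.
move=> Q1 y0 rho0 h; split; last exact: powR_ratio r0 s0 (ltW sr) Q1 y0 rho0 h.
have := powR_ratio r0 ltr01 (ltW r1) Q1 y0 rho0 h.
by rewrite (powRr1 y0) (powRr1 rho0).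
Qed.

(** The choice of [a] makes the spikes cost d rho^r, and k >= C makes the exceptional increment C
    a^r at most d rho^r. With the factor 1 + d this gives 3 d. *)
Lemma spread_spikes (d C rho a : R) k (v : james_space r1) N l :
  0 < d -> 0 <= C -> C <= k%:R -> (0 < k)%N ->
  (forall u w : R, 0 <= u -> 0 <= w -> (u + w) `^ r <= (1 + d) * u `^ r + C * w `^ r) ->
  0 <= a -> 2 * (kap k * a) = d `^ r^-1 * rho ->
  `|v| = rho -> jnorm r (tail N v) <= kap k * a -> size l = k -> all (ltn N) l ->
  `|v + bump r1 a l| `^ r <= (1 + 3 * d) * rho `^ r.
Proof.
move=> d0 C0 Ck k0 hC a0 aE vE vt lk lN.
have rho0 : 0 <= rho by rewrite -vE.
have := @norm_add_spikes _ _ r1 d C v N a l d0 C0 a0 hC (james_bv v) lN.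
rewrite lk => /(_ vt).
rewrite -/(kap k) aE -(james_normrE v) vE -(bumpE r1)// -james_seqD -james_normrE.
have E : (d `^ r^-1 * rho) `^ r = d * rho `^ r.
  by rewrite powRM ?powR_ge0// powR_root// ltW.
move=> /le_trans; apply; rewrite E.
suff : C * a `^ r <= d * rho `^ r by lra.
rewrite -E -aE mulrA [leRHS]powRM ?mulr_ge0 ?powR_ge0//.
rewrite ler_wpM2r ?powR_ge0// (le_trans Ck)//.
rewrite powRM ?powR_ge0// powR_root ?mulr_ge0 ?powR_ge0//.
rewrite mulrA ler_peMl//.
have h1 : 1 <= 2 `^ r :> R by rewrite -[leLHS](powRr0 2) ler_powR ?ler1n// ltW.
have h2 : 1 <= 2 `^ (r + 1) :> R by rewrite -[leLHS](powRr0 2) ler_powR ?ler1n//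
  addr_ge0// ltW.
by rewrite -[leLHS]mulr1 ler_pM.
Qed.

(** One endpoint is within 3/2 rho, so the other is at least rho/2 away; both distances thus exceed
    the threshold. *)
Lemma half_distance (d rho t n1 n2 : R) : 0 <= rho -> 6 * d <= 1 ->
  2 * t <= rho -> n2 <= (1 + 3 * d) * rho -> 2 * rho <= n1 + n2 -> t <= n1.
Proof.
move=> rho0 d6 t2 hn2 hn; have : 6 * d * rho <= 1 * rho by rewrite ler_wpM2r.
by lra.
Qed.

(** Averaging bounds h + t by the common bound on [n1] and [n2], which [h] nearly exhausts. What
    remains is d (2 + 3 L + 3 d) P. *)
Lemma midpoint_arith (d L P h t h1 t1 h2 t2 n1 n2 : R) : 0 < d -> 6 * d <= 1 ->
  0 <= L -> L <= B -> 0 <= P ->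
  t *+ 2 <= t1 + t2 -> h *+ 2 <= h1 + h2 -> h1 + t1 <= n1 -> h2 + t2 <= n2 ->
  n1 <= (L + d) * ((1 + 3 * d) * P) -> n2 <= (L + d) * ((1 + 3 * d) * P) ->
  (L - d) * P < h -> t <= d * (5 + 3 * B) * P.
Proof.
move=> d0 d6 L0 LB P0 ht hh s1 s2 k1 k2 lh.
apply: (@le_trans _ _ ((L + d) * ((1 + 3 * d) * P) - (L - d) * P)).
  by lra.
have -> : (L + d) * ((1 + 3 * d) * P) - (L - d) * P =
  d * (2 + 3 * L + 3 * d) * P by ring.
rewrite ler_wpM2r// ler_pM2l//; lra.
Qed.

(** With [w] half the image displacement and f (m + z) = c + u, both w + u and w - u are nearly as
    short as [w]. Since the head of [w] up to [M] carries almost all of nu w, little is left for the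
    tail of [u]. *)
Lemma compression_core (d : R) : 0 < d -> 6 * d <= 1 ->
  exists k0, forall k t, (k0 < k)%N -> exists rho a m c N M,
    [/\ t <= a, 0 < a, 0 < rho, 2 * (kap k * a) = d `^ r^-1 * rho &
     forall l, size l = k -> all (ltn N) l ->
      tl M (f (m + bump r1 a l) - c) <= d * (5 + 3 * B) * rho `^ s].
Proof.
move=> d0 d6; have [C C0 hC] := powR_addE r0 d0.
have [L /andP[L0 LB] [t0 ht0 far]] := almost_extremal d0.
exists (Num.truncn C) => k t k0.
have Ck : C <= k%:R.
  by rewrite ltW// (lt_le_trans (truncnS_gt C))// ler_nat.
have kk : 0 < kap k.
  by rewrite powR_gt0// mulr_gt0 ?powR_gt0// ltr0n (leq_ltn_trans _ k0).
(* [q] is the ratio a / rho imposed by [spread_spikes]; the pair is then taken so distant that q rho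
   >= t and rho >= 2 t0. *)
pose q : R := d `^ r^-1 / (2 * kap k).
have q0 : 0 < q by rewrite divr_gt0 ?powR_gt0 ?mulr_gt0.
have [x [y [xy nuxy]]] := far (2 * (Num.max (Num.max (t / q) (2 * t0)) 1)).
pose v := 2^-1 *: (x - y); pose rho := `|v|.
have rhoE : `|x - y| = 2 * rho.
  by rewrite /rho normrZ ger0_norm ?invr_ge0// mulrA divff ?mul1r// pnatr_eq0.
move: xy; rewrite rhoE ler_pM2l// !ge_max => /andP[/andP[trho t0rho] rho1].
have rho0 : 0 < rho by exact: lt_le_trans rho1.
pose a := q * rho; have a0 : 0 < a by rewrite mulr_gt0.
have aE : 2 * (kap k * a) = d `^ r^-1 * rho.
  rewrite /a /q mulrA mulrA; congr (_ * _); rewrite mulrC -mulrA mulVf ?mulr1//.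
  by rewrite gt_eqF// mulr_gt0.
have ka0 : 0 < kap k * a by rewrite mulr_gt0.
have [N1 hN1] := tail_small r1 (james_bv v) ka0.
have [N2 hN2] := tail_small r1 (james_bv (- v)) ka0.
pose m := 2^-1 *: (x + y); pose c := 2^-1 *: (f x + f y).
pose w := 2^-1 *: (f x - f y).
have wE : (L - d) * rho `^ s < nu w.
  rewrite /w (gaugeZ gauge) ger0_norm ?invr_ge0//.
  have s2 : 2^-1 `^ s * 2 `^ s = 1 :> R.
    by rewrite -powRM ?invr_ge0// mulVf ?pnatr_eq0// powR1.
  have -> : (L - d) * rho `^ s = 2^-1 `^ s * ((L - d) * (2 * rho) `^ s).
    by rewrite [in RHS]powRM ?(ltW rho0)// mulrCA; congr (_ * _);
      rewrite mulrA s2 mul1r.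
  by rewrite ltr_pM2l ?powR_gt0 ?invr_gt0// -rhoE.
have [M hM] := gauge_cvg gauge wE.
exists rho, a, m, c, (maxn N1 N2), M; split=> //.
  by rewrite /a mulrC -ler_pdivrMr.
move=> l lk lN; set z := bump r1 a l; pose u := f (m + z) - c.
have kpos : (0 < k)%N by rewrite (leq_ltn_trans _ k0).
have v1 : `|v + z| `^ r <= (1 + 3 * d) * rho `^ r.
  exact: (spread_spikes d0 (ltW C0) Ck kpos hC (ltW a0) aE (erefl _)
    (hN1 _ (leq_maxl _ _)) lk lN).
have v2 : `|- v + z| `^ r <= (1 + 3 * d) * rho `^ r.
  exact: (spread_spikes d0 (ltW C0) Ck kpos hC (ltW a0) aE (normrN v)
    (hN2 _ (leq_maxr _ _)) lk lN).
have Q1 : 1 <= 1 + 3 * d by rewrite lerDl mulr_ge0// ltW.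
have [n1 n1s] := powR_ratio2 Q1 (normr_ge0 (v + z)) (ltW rho0) v1.
have [n2 n2s] := powR_ratio2 Q1 (normr_ge0 (- v + z)) (ltW rho0) v2.
have vv := norm_midpoint v z.
have far1 := half_distance (ltW rho0) d6 t0rho n2 vv.
have far2 : t0 <= `|- v + z|.
  by apply: (half_distance (ltW rho0) d6 t0rho n1); rewrite addrC.
have Ld : 0 <= L + d by rewrite addr_ge0// ltW.
have k1 : nu (w + u) <= (L + d) * ((1 + 3 * d) * rho `^ s).
  have -> : w + u = f (m + z) - f y.
    by rewrite -[in RHS](half_diff (f x) (f y)) opprB addrCA.
  have E : m + z - y = v + z by exact: midpoint_subl.
  have := ht0 (m + z) y; rewrite E => /(_ far1) /le_trans; apply.
  exact: (ler_wpM2l Ld n1s).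
have k2 : nu (w - u) <= (L + d) * ((1 + 3 * d) * rho `^ s).
  have -> : w - u = f x - f (m + z).
    by rewrite -[in RHS](half_sum (f x) (f y)) opprB addrA (addrC w).
  have E : `|x - (m + z)| = `|- v + z| by rewrite midpoint_subr normrN.
  have := ht0 x (m + z); rewrite E => /(_ far2) /le_trans; apply.
  exact: (ler_wpM2l Ld n2s).
exact: (midpoint_arith d0 d6 L0 LB (powR_ge0 rho s) (gauge_tl gauge M w u)
  (gauge_hd gauge M w u) (gauge_split gauge M (w + u))
  (gauge_split gauge M (w - u)) k1 k2 (hM M (leqnn M))).
Qed.

(** The tail is O(d rho^s), whereas (k^(1/r) a)^s is a multiple of d^(s/r) rho^s. As s < r, a small
    [d] makes the quotient, of order d^(1-s/r), as small as desired. *)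
Lemma compression (eta : R) : 0 < eta -> exists k0, forall k t, (k0 < k)%N ->
  exists a m c N M, [/\ t <= a, 0 < a & forall l, size l = k -> all (ltn N) l ->
    tl M (f (m + bump r1 a l) - c) <= (eta * (k%:R `^ r^-1 * a)) `^ s].
Proof.
move=> eta0; pose K : R := 2 * (2 `^ (r + 1)) `^ r^-1.
have K0 : 0 < K by rewrite mulr_gt0 ?powR_gt0.
have B5 : 0 < 5 + 3 * B by rewrite ltr_pwDl// mulr_ge0.
pose e := (eta / K) `^ s / (5 + 3 * B).
have e0 : 0 < e by rewrite divr_gt0// powR_gt0// divr_gt0.
have sr0 : 0 < 1 - s / r by rewrite subr_gt0 ltr_pdivrMr// mul1r.
pose d := Num.min 6^-1 (e `^ (1 - s / r)^-1).
have d0 : 0 < d by rewrite lt_min invr_gt0// powR_gt0// ltr0n.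
have d6 : 6 * d <= 1 by rewrite mulrC -ler_pdivlMr// mul1r ge_min lexx.
have de : d `^ (1 - s / r) <= e.
  rewrite -[leRHS](powR_root sr0) ?(ltW e0)// le_powR ?(ltW d0)//.
  by rewrite ge_min lexx orbT.
have [k0 hk0] := compression_core d0 d6.
exists k0 => k t kk; have [rho [a [m [c [N [M [ta a0 rho0 aE h]]]]]]] := hk0 k t kk.
exists a, m, c, N, M; split=> // l lk lN; apply: le_trans (h l lk lN) _.
have aK : k%:R `^ r^-1 * a = K^-1 * (d `^ r^-1 * rho).
  rewrite -aE /kap powRM ?powR_ge0// /K.
  have A0 : (2 `^ (r + 1)) `^ r^-1 != 0 :> R by rewrite gt_eqF// !powR_gt0.
  by move: A0; set A := (2 `^ (r + 1)) `^ r^-1; set Q := k%:R `^ _ => A0; field.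
have q0 : 0 <= eta / K by rewrite divr_ge0// ltW.
have dr0 : 0 <= d `^ r^-1 by exact: powR_ge0.
rewrite aK mulrA mulrA -/(eta / K).
rewrite (powRM s (mulr_ge0 q0 dr0) (ltW rho0)) (powRM s q0 dr0).
apply: (ler_wpM2r (powR_ge0 rho s)).
have -> : (eta / K) `^ s = e * (5 + 3 * B).
  by rewrite /e divfK// gt_eqF.
have -> : d * (5 + 3 * B) = d `^ (1 - s / r) * (5 + 3 * B) * d `^ (s / r).
  by rewrite mulrAC -powRD ?(gt_eqF d0) ?implybT// subrK (powRr1 (ltW d0)).
rewrite -powRrM (mulrC r^-1) ler_wpM2r ?powR_ge0// ler_wpM2r//.
exact: ltW.
Qed.

End compression.

End lower_gauges.

(** * Estimates in a single summand *)

Section coordinates.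
Context {R : realType} (r p : R) (r1 : 1 < r) (p1 : 1 < p).
Context (U : set_system nat) {UU : UltraFilter U}.
Hypothesis Uoo : forall N, U (fun n => (N < n)%N).
Context (f : james_space r1 -> james_space p1) (theta B : R).
Hypothesis B0 : 0 < B.
Hypothesis fB : forall x y : james_space r1, theta <= `|x - y| ->
  `|f x - f y| <= B * `|x - y|.

Let r0 : 0 < r. Proof. exact: lt_trans ltr01 r1. Qed.
Let p0 : 0 < p. Proof. exact: lt_trans ltr01 p1. Qed.
Let K : R := (2 `^ (r + 1) * 2) `^ r^-1.
Let K0 : 0 < K. Proof. by rewrite !powR_gt0// mulr_gt0 ?powR_gt0. Qed.

Lemma bump_tree (m : james_space r1) (a : R) : theta <= a -> 0 < a ->
  tree p (B * (K * a)) (fun l => james_seq (f (m + bump r1 a l))).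
Proof.
move=> ta a0; split=> [s|s n n' t]; first exact: james_bv.
set x := bump r1 a (s ++ n :: t); set y := bump r1 a (s ++ n' :: t).
have h : `|f (m + x) - f (m + y)| <= B * (K * a).
  have [->|xy] := eqVneq x y.
    by rewrite subrr normr0 mulr_ge0 ?mulr_ge0// ltW.
  have E : `|(m + x) - (m + y)| = `|x - y| by rewrite opprD addrACA subrr add0r.
  have := @fB (m + x) (m + y); rewrite E.
  move=> /(_ (le_trans ta (bump_neq (ltW a0) xy))) /le_trans; apply.
  exact: (ler_wpM2l (ltW B0) (bump_change r1 s n n' t (ltW a0))).
split=> [j||].
- exact: le_trans (james_normr_ge (f (m + x) - f (m + y)) j) h.
- exact: (james_bv (f (m + x) - f (m + y))).
- by move: h; rewrite james_normrE.
Qed.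

(** Concentration gives O(k^(1/p) a), negligible against k^(1/r) a. The threshold on [k] is uniform
    in [m] and [a], which [compression] supplies only after [k] is fixed. *)
Lemma upper_coordinate (eta : R) : r < p -> 0 < eta ->
  exists k0, forall k (m : james_space r1) (a : R), (k0 < k)%N -> theta <= a -> 0 < a ->
    Ev U k (fun s t => `|f (m + bump r1 a s) - f (m + bump r1 a t)|
      <= eta * (k%:R `^ r^-1 * a)).
Proof.
move=> rp eta0; have e0 : 0 < r^-1 - p^-1 by rewrite subr_gt0 ltf_pV2.
(* Since 3 (k + 1) <= 6 k, the bound from [concentration] is at most eta X k^(1/p) a. *)
pose X : R := 6 `^ p^-1 * 10 * B * K / eta.
have X0 : 0 < X.
  by rewrite divr_gt0// mulr_gt0// mulr_gt0// mulr_gt0// powR_gt0.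
exists (Num.truncn (X `^ (r^-1 - p^-1)^-1)) => k m a kk ta a0.
have kpos : 1 <= k%:R :> R by rewrite ler1n (leq_ltn_trans _ kk).
have kpos0 : 0 < k%:R :> R := lt_le_trans ltr01 kpos.
have Xk : X <= k%:R `^ (r^-1 - p^-1).
  rewrite -[leLHS](powR_root e0) ?(ltW X0)//.
  apply: (le_powR e0 (powR_ge0 _ _)).
  by rewrite ltW// (lt_le_trans (truncnS_gt _))// ler_nat.
have L0 : 0 < B * (K * a) by rewrite !mulr_gt0.
have := @concentration R p p1 U UU Uoo _ _ k 0%N 1 L0 ltr01 (bump_tree m ta a0).
apply: Ev_impl => s t _ _ [_ hPhi].
have M0 : 0 <= k.+1%:R * (3 * (10 * (B * (K * a))) `^ p).
  by rewrite mulr_ge0// mulr_ge0// powR_ge0.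
have [_] := jn_Phi p1 M0 hPhi.
rewrite james_normrE => /le_trans; apply.
have L10 : 0 <= 10 * (B * (K * a)) by rewrite mulr_ge0// ltW.
rewrite mulrA powRM ?powR_ge0//.
rewrite (root_powR p0 L10).
apply: (@le_trans _ _ ((6 * k%:R) `^ p^-1 * (10 * (B * (K * a))))).
  rewrite ler_wpM2r// le_powR ?invr_gt0 ?mulr_ge0//.
  by rewrite -natr1; move: kpos; lra.
have kE : k%:R `^ r^-1 = k%:R `^ p^-1 * k%:R `^ (r^-1 - p^-1).
  by rewrite -powRD ?(gt_eqF kpos0) ?implybT// addrC subrK.
rewrite powRM// kE.
have -> : 6 `^ p^-1 * k%:R `^ p^-1 * (10 * (B * (K * a))) =
  eta * (k%:R `^ p^-1 * X * a).
  have en0 : eta != 0 by rewrite gt_eqF.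
  by rewrite /X; set u := 6 `^ _; set v := k%:R `^ _; field.
by rewrite ler_pM2l// ler_pM2r// ler_wpM2l ?powR_ge0.
Qed.

(** [x] minus its tail lives on [0, N), where each entry is a difference of two controlled
    coordinates; hence the factor 1/2 in the choice of [d]. *)
Lemma jn_tail_close N (e : R) : 0 < e -> exists2 d : R, 0 < d &
  forall x, bv p x -> (forall j, (j <= N)%N -> `|x j| <= d) ->
  jnorm p x <= jnorm p (tail N x) + e.
Proof.
move=> e0; pose k : R := (2 `^ (p + 1) * (size (iota 0 N))%:R) `^ p^-1.
have k0 : 0 <= k by exact: powR_ge0.
have k1 : 0 < k + 1 by rewrite ltr_wpDl.
have d0 : 0 < e / (k + 1) / 2 by rewrite divr_gt0// divr_gt0.
exists (e / (k + 1) / 2) => // x xf xd.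
have xE : x = tail N x \+ (x \- tail N x).
  by apply/funext => j /=; rewrite addrC subrK.
have tf := bv_tail p1 N xf; have df := bvB p1 xf tf.
rewrite {1}xE (le_trans (jnD p1 tf df))// lerD2l.
have [_ h] : bv p (x \- tail N x) /\ jnorm p (x \- tail N x) <= k * (e / (k + 1)).
  apply: (jn_supp p1) => [|j|j].
  - by rewrite divr_ge0// ltW.
  - have [Nj|jN] := leqP N j.
      by rewrite /tail /= (maxn_idPr Nj) subrr normr0 divr_ge0// ltW.
    rewrite /tail /= (maxn_idPl (ltnW jN)) [leRHS]splitr.
    by rewrite (le_trans (ler_normB _ _))// lerD// xd// ltnW.
  - rewrite mem_iota /= add0n -leqNgt => Nj.
    by rewrite /tail /= (maxn_idPr Nj) subrr.
apply: le_trans h _.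
by rewrite mulrCA ger_pMr// ler_pdivrMr// mul1r lerDl.
Qed.

(** The tails of the two images, compared through [c], cost [b] each. The closeness clause of
    [concentration] makes the first [M] coordinates cost one more. *)
Lemma lower_coordinate k (m : james_space r1) (a : R) (c : james_space p1)
    N M (b : R) : 0 < b -> theta <= a -> 0 < a ->
  (forall l, size l = k -> all (ltn N) l ->
    jnorm p (tail M (f (m + bump r1 a l) - c)) <= b) ->
  Ev U k (fun s t => `|f (m + bump r1 a s) - f (m + bump r1 a t)| <= 3 * b).
Proof.
move=> b0 ta a0 hb; have [d d0 hd] := jn_tail_close M b0.
have L0 : 0 < B * (K * a) by rewrite !mulr_gt0.
have h1 := @concentration R p p1 U UU Uoo _ _ k M d L0 d0 (bump_tree m ta a0).
have h2 := @Ev_interlaced U UU Uoo k N.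
have := @Ev_and U UU k _ _ h1 h2;
  apply: Ev_impl => s t sk tk [[close _] /interlaced_mem[sN tN]].
have sb := hb s sk; have tb := hb t tk.
set X := f (m + bump r1 a s) in sb close *; set Y := f (m + bump r1 a t) in tb close *.
have {}sb : jnorm p (tail M (X - c)) <= b.
  by apply: sb; apply/allP => j /sN[].
have {}tb : jnorm p (tail M (Y - c)) <= b.
  by apply: tb; apply/allP => j /tN[].
rewrite james_normrE (le_trans (hd _ (james_bv (X - Y)) close))//.
have sf := bv_tail p1 M (james_bv (X - c)); have tf := bv_tail p1 M (james_bv (Y - c)).
have := jnB p1 sf tf; rewrite (_ : _ \- _ = tail M (X - Y)); first by lra.
rewrite !james_seqB; apply/funext => j; rewrite /tail /=; ring.
Qed.

End coordinates.

(** * The lower bound and the contradiction *)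

Section incompressibility.
Context {R : realType}.

Lemma nat_ultrafilter : exists2 U : set_system nat,
  UltraFilter U & forall N, U (fun n => (N < n)%N).
Proof.
have [U [UU sU]] := ultraFilterLemma eventually_filter.
by exists U => // N; apply: sU; exact: nbhs_infty_gt.
Qed.

Lemma norm_fst (V W : normedModType R) (x y : V * W) : `|x.1 - y.1| <= `|x - y|.
Proof. by rewrite prod_normE le_max lexx. Qed.

Lemma norm_snd (V W : normedModType R) (x y : V * W) : `|x.2 - y.2| <= `|x - y|.
Proof. by rewrite prod_normE le_max lexx orbT. Qed.

Variables (p q r : R) (p1 : 1 < p) (q1 : 1 < q) (r1 : 1 < r).
Local Notation Y := (james_space p1 * james_space q1)%type.
Variables (f : james_space r1 -> Y) (theta A : R).
Hypothesis A0 : 0 < A.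
Hypothesis fA : forall x y : james_space r1, theta <= `|x - y| ->
  A * `|x - y| <= `|f x - f y|.

(** Some interlaced s, t satisfy both estimates; their bumps are at least k^(1/r) a apart, so the
    lower bound with constant A > eta fails in the max norm. *)
Lemma not_compressed U (UU : UltraFilter U) (Uoo : forall N, U (fun n => (N < n)%N))
    k (m : james_space r1) (a eta : R) : (0 < k)%N -> theta <= a -> 0 < a -> eta < A ->
  Ev U k (fun s t => `|(f (m + bump r1 a s)).1 - (f (m + bump r1 a t)).1|
      <= eta * (k%:R `^ r^-1 * a)) ->
  Ev U k (fun s t => `|(f (m + bump r1 a s)).2 - (f (m + bump r1 a t)).2|
      <= eta * (k%:R `^ r^-1 * a)) -> False.
Proof.
move=> k0 ta a0 etaA h1 h2.
have h3 := @Ev_and U UU k _ _ h1 h2.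
have h4 := @Ev_and U UU k _ _ h3 (@Ev_interlaced U UU Uoo k 0%N).
have [s [t [sk tk [[g1 g2] st]]]] := @Ev_ex U UU k _ h4.
have := bump_interlaced r1 (ltW a0) st; rewrite sk.
set x := bump r1 a s in g1 g2 *; set y := bump r1 a t in g1 g2 *; move=> xy.
have k1 : 1 <= k%:R `^ r^-1.
  rewrite -[leLHS](powRr0 k%:R) ler_powR ?ler1n//.
  by rewrite invr_ge0 ltW// (lt_trans ltr01).
have ka0 : 0 < k%:R `^ r^-1 * a by rewrite mulr_gt0// (lt_le_trans ltr01).
have E : `|(m + x) - (m + y)| = `|x - y| by rewrite opprD addrACA subrr add0r.
have far : theta <= `|(m + x) - (m + y)|.
  have aka : a <= k%:R `^ r^-1 * a by exact: (ler_peMl (ltW a0) k1).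
  by rewrite E; exact: (le_trans ta (le_trans aka xy)).
have := fA far; rewrite E prod_normE leNgt => /negP; apply.
have lt1 : eta * (k%:R `^ r^-1 * a) < A * `|x - y|.
  apply: (@lt_le_trans _ _ (A * (k%:R `^ r^-1 * a))).
    by rewrite ltr_pM2r.
  exact: (ler_wpM2l (ltW A0) xy).
rewrite gt_max; apply/andP; split.
  exact: (le_lt_trans g1 lt1).
exact: (le_lt_trans g2 lt1).
Qed.

End incompressibility.

Unset Implicit Arguments.
Set Strict Implicit.

Theorem corollary3p7 (R : realType) (p q r : R)
    (p1 : 1 < p) (pq : p < q) (r1 : 1 < r) (rp : r != p) (rq : r != q) :
  ~ coarse_lipschitz_embeds
      (norm_metric (james_space r1))
      (norm_metric (james_space p1 * james_space (lt_trans p1 pq))%type).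
Proof.
move=> [f [theta [A [B [theta0 A0 B0 hf]]]]].
set q1 := lt_trans p1 pq in f hf *.
pose g (x : james_space r1) : (james_space p1 * james_space q1)%type := f x.
have gA (x y : james_space r1) : theta <= `|x - y| -> A * `|x - y| <= `|g x - g y|.
  by move=> /hf /andP[].
have gB (x y : james_space r1) : theta <= `|x - y| -> `|g x - g y| <= B * `|x - y|.
  by move=> /hf /andP[].
have gB1 (x y : james_space r1) : theta <= `|x - y| ->
    `|(g x).1 - (g y).1| <= B * `|x - y|.
  by move=> h; exact: (le_trans (norm_fst (g x) (g y)) (gB _ _ h)).
have gB2 (x y : james_space r1) : theta <= `|x - y| ->
    `|(g x).2 - (g y).2| <= B * `|x - y|.
  by move=> h; exact: (le_trans (norm_snd (g x) (g y)) (gB _ _ h)).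
have [U UU Uoo] := nat_ultrafilter.
have p0 : 0 < p := lt_trans ltr01 p1; have q0 : 0 < q := lt_trans ltr01 q1.
(* [lower_coordinate] triples the error, and 3 A / 4 is still below [A]. *)
pose e := A / 4; have e0 : 0 < e by rewrite divr_gt0.
have e3A : 3 * e < A by rewrite /e; lra.
have e30 : 0 < 3 * e by rewrite mulr_gt0.
have contra := @not_compressed R p q r p1 q1 r1 g theta A A0 gA U UU Uoo.
have upper1 := @upper_coordinate R r p r1 p1 U UU Uoo (fun x => (g x).1) theta B B0
  gB1 (3 * e).
have upper2 := @upper_coordinate R r q r1 q1 U UU Uoo (fun x => (g x).2) theta B B0
  gB2 (3 * e).
have scale k a : (0 < k)%N -> 0 < a -> 0 < k%:R `^ r^-1 * a :> R.
  by move=> k0 a0; rewrite mulr_gt0// powR_gt0// ltr0n.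
have powB (s u v : R) : 0 < s -> 0 <= u -> 0 <= v -> u <= B * v ->
    u `^ s <= B `^ s * v `^ s.
  by move=> s0 u0 v0 uv; rewrite -(powRM s (ltW B0) v0) le_powR.
have lower1 k (m : james_space r1) (a : R) (c : james_space p1) N M :
    (0 < k)%N -> theta <= a -> 0 < a ->
    (forall l, size l = k -> all (ltn N) l ->
      jnorm p (tail M ((g (m + bump r1 a l)).1 - c)) <= e * (k%:R `^ r^-1 * a)) ->
    Ev U k (fun s t => `|(g (m + bump r1 a s)).1 - (g (m + bump r1 a t)).1|
      <= 3 * e * (k%:R `^ r^-1 * a)).
  move=> k0 ta a0 h; rewrite -mulrA.
  exact: (@lower_coordinate R r p r1 p1 U UU Uoo (fun x => (g x).1) theta B B0 gB1
    k m a c N M _ (mulr_gt0 e0 (scale k a k0 a0)) ta a0 h).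
have lower2 k (m : james_space r1) (a : R) (c : james_space q1) N M :
    (0 < k)%N -> theta <= a -> 0 < a ->
    (forall l, size l = k -> all (ltn N) l ->
      jnorm q (tail M ((g (m + bump r1 a l)).2 - c)) <= e * (k%:R `^ r^-1 * a)) ->
    Ev U k (fun s t => `|(g (m + bump r1 a s)).2 - (g (m + bump r1 a t)).2|
      <= 3 * e * (k%:R `^ r^-1 * a)).
  move=> k0 ta a0 h; rewrite -mulrA.
  exact: (@lower_coordinate R r q r1 q1 U UU Uoo (fun x => (g x).2) theta B B0 gB2
    k m a c N M _ (mulr_gt0 e0 (scale k a k0 a0)) ta a0 h).
have [rltp|pltr] : r < p \/ p < r by move: rp; rewrite neq_lt => /orP[]; [left|right].
  (* Case r < p < q: concentration handles both summands, so m = 0 and a = theta suffice. *)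
  have [k1 h1] := upper1 rltp e30; have [k2 h2] := upper2 (lt_trans rltp pq) e30.
  pose k := (maxn k1 k2).+1.
  have hk1 : (k1 < k)%N by rewrite ltnS leq_maxl.
  have hk2 : (k2 < k)%N by rewrite ltnS leq_maxr.
  exact: (contra k 0 theta (3 * e) isT (lexx _) theta0 e3A
    (h1 k 0 theta hk1 (lexx _) theta0) (h2 k 0 theta hk2 (lexx _) theta0)).
have [rltq|qltr] : r < q \/ q < r by move: rq; rewrite neq_lt => /orP[]; [left|right].
  (* Case p < r < q: compression in J_p supplies [m] and [a], and concentration applies in J_q at
     the same points. *)
  have fBs (x y : james_space r1) : theta <= `|x - y| ->
      `|(g x).1 - (g y).1| `^ p <= B `^ p * `|x - y| `^ p.
    by move=> h; exact: (powB _ _ _ p0 (normr_ge0 _) (normr_ge0 _) (gB1 _ _ h)).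
  have [k1 h1] := compression (james_lower_gauge p1 (lexx p)) p0 pltr
    (powR_ge0 B p) fBs e0.
  have [k2 h2] := upper2 rltq e30.
  pose k := (maxn k1 k2).+1.
  have hk1 : (k1 < k)%N by rewrite ltnS leq_maxl.
  have hk2 : (k2 < k)%N by rewrite ltnS leq_maxr.
  have [a [m [c [N [M [ta a0 h]]]]]] := h1 k theta hk1.
  have s0 := scale k a isT a0.
  have h3 l : size l = k -> all (ltn N) l ->
      jnorm p (tail M ((g (m + bump r1 a l)).1 - c)) <= e * (k%:R `^ r^-1 * a).
    move=> lk lN; have hl := h l lk lN.
    exact: (powR_le_cancel p1 (jn_ge0 _ _) (ltW (mulr_gt0 e0 s0)) hl).
  exact: (contra k m a (3 * e) isT ta a0 e3A
    (lower1 k m a c N M isT ta a0 h3) (h2 k m a hk2 ta a0)).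
(* Case p < q < r: both tails must be small for the same [m] and [a], so compression is applied once
   to the product, with exponent [q]. *)
have fBs (x y : james_space r1) : theta <= `|x - y| ->
    `|(g x - g y).1| `^ q + `|(g x - g y).2| `^ q <= (B `^ q + B `^ q) * `|x - y| `^ q.
  move=> h; rewrite mulrDl; apply: lerD.
    exact: (powB _ _ _ q0 (normr_ge0 _) (normr_ge0 _) (gB1 _ _ h)).
  exact: (powB _ _ _ q0 (normr_ge0 _) (normr_ge0 _) (gB2 _ _ h)).
have gauge := lower_gauge_prod (james_lower_gauge p1 (ltW pq)) (james_lower_gauge q1
  (lexx q)).
have [k1 h1] := compression gauge q0 qltr (addr_ge0 (powR_ge0 B q) (powR_ge0 B q))
  fBs e0.
have [a [m [c [N [M [ta a0 h]]]]]] := h1 k1.+1 theta (ltnSn k1).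
have s0 := scale k1.+1 a isT a0.
have h3 l : size l = k1.+1 -> all (ltn N) l ->
    jnorm p (tail M ((g (m + bump r1 a l)).1 - c.1)) <= e * (k1.+1%:R `^ r^-1 * a).
  move=> lk lN; have hl := le_trans _ (h l lk lN).
  apply: (powR_le_cancel q1 (jn_ge0 _ _) (ltW (mulr_gt0 e0 s0))); apply: hl.
  by rewrite lerDl powR_ge0.
have h4 l : size l = k1.+1 -> all (ltn N) l ->
    jnorm q (tail M ((g (m + bump r1 a l)).2 - c.2)) <= e * (k1.+1%:R `^ r^-1 * a).
  move=> lk lN; have hl := le_trans _ (h l lk lN).
  apply: (powR_le_cancel q1 (jn_ge0 _ _) (ltW (mulr_gt0 e0 s0))); apply: hl.
  by rewrite lerDr powR_ge0.
exact: (contra k1.+1 m a (3 * e) isT ta a0 e3A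
  (lower1 k1.+1 m a c.1 N M isT ta a0 h3) (lower2 k1.+1 m a c.2 N M isT ta a0 h4)).
Qed.
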